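(* Let $n\in\mathbb N=\{1,2,\dots\}$, $s\in(0,1)$, $p\in(1,\infty)$ be such that $sp\le n$. For any $x\in\mathbb R^n\setminus\{0\}$, define $$u_0(x)=\begin{cases}|x|^{\frac{sp-n}{p-1}} & \text{if } sp<n,\\ \ln\frac1{|x|} & \text{if } sp=n.\end{cases}$$ Then there exists a constant $c^\ast_{n,s,p}$ such that $$u=\begin{cases}(c^\ast_{n,s,p})^{-\frac1{p-1}}\,u_0 & \text{if } c^\ast_{n,s,p}\ge0,\\ -(-c^\ast_{n,s,p})^{-\frac1{p-1}}\,u_0 & \text{if } c^\ast_{n,s,p}<0,\end{cases}$$ is a solution to $(-\Delta)^s_pu=\delta_0$ weakly in $\mathbb R^n$ in the following sense: for all $\phi\in C_c^\infty(\mathbb R^n)$, $$\frac12\int_{\mathbb R^n}\int_{\mathbb R^n}\frac{|u(x)-u(y)|^{p-2}(u(x)-u(y))(\phi(x)-\phi(y))}{|x-y|^{n+sp}}\,dy\,dx=\phi(0).$$ Indeed, the constant $c^\ast_{n,s,p}$ is given by $$c^\ast_{n,s,p}=\frac12\int_{\mathbb R^n}\int_{\mathbb R^n}\frac{|u_0(x)-u_0(y)|^{p-2}(u_0(x)-u_0(y))\left(|x-\mathbf e_1|^{s-n}-|y-\mathbf e_1|^{s-n}\right)}{|x-y|^{n+sp}}\,dy\,dx .$$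
   Context: $\mathbf e_1=(1,0,\dots,0)\in\mathbb R^n$; $\delta_0$ is the Dirac measure at the origin of $\mathbb R^n$; $C_c^\infty(\mathbb R^n)$ is the space of infinitely differentiable functions on $\mathbb R^n$ with compact support. The fractional $p$-Laplace operator is $(-\Delta)^s_pu(x)=\mathrm{p.v.}\int_{\mathbb R^n}\frac{|u(x)-u(y)|^{p-2}(u(x)-u(y))}{|x-y|^{n+sp}}\,dy$; in the claim the equation is understood in the weak sense displayed there. *)

(* Defs.v *)
From HB Require Import structures.
From mathcomp Require Import all_boot all_order all_algebra.
From mathcomp Require Import all_classical all_reals all_analysis.

Set Implicit Arguments.
Unset Strict Implicit.
Unset Printing Implicit Defensive.
Import Order.TTheory GRing.Theory Num.Theory.
Import numFieldNormedType.Exports.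

Local Open Scope classical_set_scope.
Local Open Scope ring_scope.

(* The sigma-algebra generated by the coordinates, i.e. the Borel one, built as
   in the library for n-tuples. *)
Section measurable_rV.
Context {R : realType} (n : nat).

Definition rVcoord (i : 'I_n) (x : 'rV[R]_n) : measurableTypeR R := x ord0 i.

HB.instance Definition _ := @isMeasurable.Build
  (measure_tuple_display (R.-ocitv.-measurable).-sigma)
  'rV[R]_n (g_sigma_preimage rVcoord) (@sigma_algebra0 _ _ _)
  (@sigma_algebraC _ _) (@sigma_algebra_bigcup _ _ _).

Lemma measurable_rVcoord (i : 'I_n) : measurable_fun [set: 'rV[R]_n] (rVcoord i).
Proof.
move=> _ Y mY; rewrite setTI; apply: sub_sigma_algebra => /=.
rewrite -bigcup_seq/=; exists i => /=; first by rewrite mem_index_enum.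
by exists Y => //; rewrite setTI.
Qed.

End measurable_rV.

Lemma measurable_fun_rV (R : realType) (n : nat) d (T : measurableType d) (f : T -> 'rV[R]_n) :
  (forall i, measurable_fun [set: T] (rVcoord i \o f)) ->
  measurable_fun [set: T] f.
Proof.
move=> mf.
have prefS : g_sigma_preimage (fun i => rVcoord i \o f) `<=` measurable.
  apply: smallest_sub; first exact: sigma_algebra_measurable.
  case: n => [|m] in f mf *; first by rewrite big_ord0.
  rewrite -bigcup_mkord_ord; apply: bigcup_sub => i Ii.
  by move=> A [B mB <-]; exact: mf.
move: prefS; rewrite g_sigma_preimage_comp => prefS _ A mA.
by apply: prefS; exists A.
Qed.

Section lebesgue_cons.
Context {R : realType} (n : nat).

Definition rVcons (z : measurableTypeR R * 'rV[R]_n) : 'rV[R]_n.+1 :=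
  row_mx (z.1 : R)%:M z.2.

Lemma rVcons0 z : rVcoord ord0 (rVcons z) = z.1.
Proof.
rewrite /rVcoord (_ : ord0 = lshift n (ord0 : 'I_1)); last exact/val_inj.
by apply: (etrans (row_mxEl _ _ _ _)); rewrite mxE eqxx mulr1n.
Qed.

Lemma rVconsS z (i : 'I_n) : rVcoord (lift ord0 i) (rVcons z) = rVcoord i z.2.
Proof.
rewrite /rVcoord (_ : lift ord0 i = rshift 1 i); last exact/val_inj.
exact: row_mxEr.
Qed.

Lemma rVcons_box (A : 'I_n.+1 -> set R) :
  rVcons @^-1` [set x : 'rV[R]_n.+1 | forall i, A i (x ord0 i)] =
  A ord0 `*` [set y : 'rV[R]_n | forall i, A (lift ord0 i) (y ord0 i)].
Proof.
apply/seteqP; split => z /=.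
  move=> Az; split; first by rewrite -[z.1]rVcons0; exact: Az.
  by move=> i; rewrite -[z.2 _ _]/(rVcoord i z.2) -rVconsS; exact: Az.
move=> [Az1 Az2] i; rewrite -[rVcons z _ _]/(rVcoord i (rVcons z)).
case: (unliftP ord0 i) => [j|] ->; first by rewrite rVconsS; exact: Az2.
by rewrite rVcons0.
Qed.

Lemma measurable_rVcons :
  measurable_fun [set: measurableTypeR R * 'rV[R]_n] rVcons.
Proof.
apply: measurable_fun_rV => i; case: (unliftP ord0 i) => [j|] ->.
  rewrite (_ : _ \o _ = rVcoord j \o snd).
    by apply: measurableT_comp => //; exact: measurable_rVcoord.
  by apply/funext => z; rewrite /= rVconsS.
rewrite (_ : _ \o _ = fst); first exact: measurable_fst.
by apply/funext => z; rewrite /= rVcons0.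
Qed.

Lemma measurable_rVtail :
  measurable_fun [set: 'rV[R]_n.+1] (fun x => \row_i x ord0 (lift ord0 i)).
Proof.
apply: measurable_fun_rV => i.
rewrite (_ : _ \o _ = rVcoord (lift ord0 i)); first exact: measurable_rVcoord.
by apply/funext => x; rewrite /rVcoord /= mxE.
Qed.

Variable mu : {sigma_finite_measure set 'rV[R]_n -> \bar R}.

Definition lebesgue_cons : set 'rV[R]_n.+1 -> \bar R :=
  pushforward (lebesgue_measure \x mu)%E rVcons.

Let lebesgue_cons0 : lebesgue_cons set0 = 0%E.
Proof. by rewrite /lebesgue_cons /pushforward preimage_set0 measure0. Qed.

Let lebesgue_cons_ge0 A : (0 <= lebesgue_cons A)%E.
Proof. by rewrite /lebesgue_cons /pushforward. Qed.

Let lebesgue_cons_sigma_additive : semi_sigma_additive lebesgue_cons.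
Proof.
have mpre (B : set 'rV[R]_n.+1) : measurable B -> measurable (rVcons @^-1` B).
  by move=> mB; rewrite -[X in measurable X]setTI; exact: measurable_rVcons.
move=> F mF tF mUF; rewrite /lebesgue_cons /pushforward preimage_bigcup.
apply: measure_semi_sigma_additive.
- by move=> k; apply: mpre; exact: mF.
- apply/trivIsetP => /= i j _ _ ij; rewrite -preimage_setI.
  by move/trivIsetP : tF => /(_ _ _ _ _ ij) ->//; rewrite preimage_set0.
- by rewrite -preimage_bigcup; exact: mpre.
Qed.

HB.instance Definition _ := isMeasure.Build _ _ _ lebesgue_cons
  lebesgue_cons0 lebesgue_cons_ge0 lebesgue_cons_sigma_additive.

Let lebesgue_cons_sigma_finite : sigma_finite setT lebesgue_cons.
Proof.
have /sigma_finiteP[F [TF ndF Foo]] := sigma_finiteT (@lebesgue_measure R).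
have /sigma_finiteP[G [TG ndG Goo]] := sigma_finiteT mu.
pose tl (x : 'rV[R]_n.+1) : 'rV[R]_n := \row_i x ord0 (lift ord0 i).
have tlK z : tl (rVcons z) = z.2.
  by apply/rowP => i; rewrite mxE -/(rVcoord _ _) rVconsS.
exists (fun k => (rVcoord ord0 @^-1` F k) `&` (tl @^-1` G k)).
  apply/seteqP; split => // x _.
  have [i _ Fi] : (\bigcup_i F i) (rVcoord ord0 x) by rewrite -TF.
  have [j _ Gj] : (\bigcup_i G i) (tl x) by rewrite -TG.
  exists (maxn i j) => //; split.
    by have /subsetPset sF := ndF _ _ (leq_maxl i j); exact: sF.
  by have /subsetPset sG := ndG _ _ (leq_maxr i j); exact: sG.
move=> k; have [mF Fk] := Foo k; have [mG Gk] := Goo k; split.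
  apply: measurableI; rewrite -[X in measurable X]setTI.
    exact: measurable_rVcoord.
  exact: measurable_rVtail.
rewrite /lebesgue_cons /pushforward (_ : _ @^-1` _ = F k `*` G k).
  by rewrite product_measure1E// lte_mul_pinfty// ge0_fin_numE.
by apply/seteqP; split => z /=; rewrite rVcons0 tlK.
Qed.

HB.instance Definition _ := Measure_isSigmaFinite.Build _ _ _ lebesgue_cons
  lebesgue_cons_sigma_finite.

End lebesgue_cons.

(* Lebesgue measure on R^n as an n-fold product measure; lebesgue_rV_box below
   gives its value on product sets, which characterizes it. *)
Fixpoint lebesgue_rV (R : realType) (n : nat) :
    {sigma_finite_measure set 'rV[R]_n -> \bar R} :=
  if n is m.+1 then lebesgue_cons (lebesgue_rV R m) else dirac (0 : 'rV[R]_0).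

Section lebesgue_rV_box.
Context {R : realType}.

Lemma measurable_rVbox n (A : 'I_n -> set (measurableTypeR R)) :
  (forall i, measurable (A i)) ->
  measurable [set x : 'rV[R]_n | forall i, A i (x ord0 i)].
Proof.
move=> mA; rewrite (_ : mkset _ = \big[setI/setT]_(i < n) (rVcoord i @^-1` A i)).
  apply: bigsetI_measurable => i _; rewrite -[X in measurable X]setTI.
  exact: measurable_rVcoord.
rewrite -bigcap_seq; apply/seteqP; split => x /= Ax i.
  by move=> _; exact: Ax.
by apply: Ax; rewrite /= mem_index_enum.
Qed.

Lemma lebesgue_rV_box n (A : 'I_n -> set (measurableTypeR R)) :
  (forall i, measurable (A i)) ->
  lebesgue_rV R n [set x | forall i, A i (x ord0 i)] =
  (\prod_(i < n) lebesgue_measure (A i))%E.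
Proof.
elim: n A => [|n IHn] A mA.
  by rewrite big_ord0 /= diracE mem_set//= => -[].
rewrite big_ord_recl /= /lebesgue_cons /pushforward rVcons_box.
rewrite product_measure1E//.
  by rewrite (IHn (fun i => A (lift ord0 i))).
exact: (measurable_rVbox (A := fun i => A (lift ord0 i))).
Qed.

End lebesgue_rV_box.

Section test_functions.
Context {R : realType} (n : nat).
Implicit Type f : 'rV[R]_n -> R.

(* The Euclidean norm; the norm of the library on 'rV[R]_n is the sup norm. *)
Definition enorm (x : 'rV[R]_n) : R := Num.sqrt (\sum_(i < n) x ord0 i ^+ 2).

Definition iter_partial (l : seq 'I_n) f : 'rV[R]_n -> R :=
  foldr (fun i (g : 'rV[R]_n -> R) => 'D_('e_i) g) f l.

Definition smooth f : Prop :=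
  forall l : seq 'I_n, continuous (iter_partial l f) /\
    forall (i : 'I_n) (x : 'rV[R]_n), derivable (iter_partial l f) x 'e_i.

Definition Cc_infty f : Prop :=
  smooth f /\ compact (closure [set x | f x != 0]).

End test_functions.

Section fractional_p_laplacian.
Context {R : realType} (n : nat).
Implicit Types (s p : R) (u phi : 'rV[R]_n -> R).

(* In the library 0 to a negative power and division by 0 are both 0: this
   vanishes on the diagonal, and where u x = u y even when p < 2. *)
Definition energy_integrand s p u phi (x y : 'rV[R]_n) : R :=
  `|u x - u y| `^ (p - 2) * (u x - u y) * (phi x - phi y)
    / enorm (x - y) `^ (n%:R + s * p).

Definition energy s p u phi : \bar R :=
  ((2^-1)%:E * \int[lebesgue_rV R n]_x \int[lebesgue_rV R n]_y
    (energy_integrand s p u phi x y)%:E)%E.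

(* Absolute convergence of the double integral; without it the iterated
   integral may be a junk value. *)
Definition energy_integrable s p u phi : Prop :=
  (lebesgue_rV R n \x lebesgue_rV R n)%E.-integrable setT
    (fun z => (energy_integrand s p u phi z.1 z.2)%:E).

Definition weak_solution_dirac s p u : Prop :=
  forall phi, Cc_infty phi ->
    energy_integrable s p u phi /\ energy s p u phi = (phi 0)%:E.

(* The value at the origin is immaterial. *)
Definition u0 s p (x : 'rV[R]_n) : R :=
  if s * p == n%:R then ln (1 / enorm x)
  else enorm x `^ ((s * p - n%:R) / (p - 1)).

Definition fundamental_solution s p (c : R) (x : 'rV[R]_n) : R :=
  if 0 <= c then c `^ (- (1 / (p - 1))) * u0 s p x
  else - ((- c) `^ (- (1 / (p - 1)))) * u0 s p x.

Definition e1 : 'rV[R]_n := \row_(j < n) ((j : nat) == 0)%:R.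

Definition shifted_power s (x : 'rV[R]_n) : R := enorm (x - e1) `^ (s - n%:R).

End fractional_p_laplacian.

(* Main.v *)
Require Import Defs.
From mathcomp Require Import all_boot all_order all_algebra.
From mathcomp Require Import all_classical all_reals all_analysis.
From mathcomp Require Import measurable_realfun ring lra.
Import Order.TTheory GRing.Theory Num.Theory.
Import numFieldNormedType.Exports.
Set Implicit Arguments.
Unset Strict Implicit.
Unset Printing Implicit Defensive.
Local Open Scope classical_set_scope.
Local Open Scope ring_scope.

(* Write K(x, y) for the kernel |u0 x - u0 y|^(p-2) (u0 x - u0 y) / |x - y|^(n+sp)
   and T(phi) for the integral of K(x, y) (phi x - phi y). The kernel is
   antisymmetric, invariant under linear isometries and homogeneous of degree
   -2n under dilations. Let K_eps be K restricted to the pairs with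
   |x - y| > eps |x| and |x - y| > eps |y|: it has the same symmetries, and
   the integral of K_eps(x, y) over y is absolutely convergent, hence equal to
   k_eps |x|^(-n). By antisymmetry, the form T_eps of K_eps is
   T_eps(psi) = 2 k_eps int psi |x|^(-n) whenever psi |x|^(-n) is integrable.
   For psi = chi - chi(2 .) with chi a radial cutoff, T_eps(psi) = 0 by
   dilation invariance while the integral of psi |x|^(-n) is positive, so
   k_eps = 0. Letting eps tend to 0, T(psi) = 0 for every admissible psi
   vanishing at 0 (in an integrated sense), hence T(phi) = phi(0) T(chi). This
   applies both to test functions and to |x - e1|^(s-n), whose value at 0 is 1,
   so that c = T(chi) / 2, and T(chi) > 0 because u0 and chi are both radially
   decreasing. *)

(** * Lebesgue measure on R^n *)

(** The obstacle is the diagonal. For fixed x the kernel is in general of size |x - y|^(p-1-n-sp)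
    near y = x, so K(x, .) fails to be absolutely integrable when sp >= p - 1, and T(phi) cannot be
    split into its phi(x) and phi(y) parts; the truncation restores that splitting. Convergence of
    T(phi) itself is governed by an exponent [eta]. The function |K(e1, y)| |e1 - y|^eta is
    integrable near e1 when sp < p - 1 + eta, while |x - e1|^(s-n) has increments bounded by |x -
    y|^eta times values of |x - e1|^(s-n-eta), which is locally integrable when eta < s. Both can be
    met because sp - (p - 1) < s amounts to (p - 1)(1 - s) > 0. By homogeneity the integral of |K(x,
    y)| |x - y|^eta over y is a multiple of |x|^(eta-n); this dictates the integrability asked for
    in [weight], and puts test functions and the shifted power in a single class. As T(chi) > 0,
    only the first branch of [fundamental_solution] occurs. *)

Local Notation pushm := measure_function_pushforward__canonical__measure_function_Measure.

Section affine_change_of_variables.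
Context {R : realType}.
Local Open Scope ereal_scope.

(** Uniqueness of Lebesgue measure reduces this to half-open intervals, whose preimages are
    half-open intervals with length divided by [a]. *)
Lemma lebesgue_measure_affine (a b : R) (a0 : (0 < a)%R)
    (phi := (fun t => a * t + b)%R : measurableTypeR R -> measurableTypeR R)
    (A : set (measurableTypeR R)) : measurable A ->
  lebesgue_measure A = a%:E * lebesgue_measure (phi @^-1` A).
Proof.
move=> mA.
have mphi : measurable_fun [set: measurableTypeR R] phi.
  by apply: measurable_funD => //; exact: measurable_funM.
apply: (@lebesgue_measure_unique R
  (mscale (NngNum (ltW a0)) (pushm lebesgue_measure mphi))) => //.
move=> _ [[x y]] _ <- /=.
rewrite /mscale /= /pushforward.
have -> : phi @^-1` `]x, y]%classic = `]((x - b) / a)%R, ((y - b) / a)%R]%classic.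
  apply/seteqP; split => t /=; rewrite !in_itv /= /phi ltr_pdivrMr// ler_pdivlMr// ltrBlDr lerBrDr (mulrC t)//.
rewrite !lebesgue_measure_itv/= !lte_fin ltr_pM2r ?invr_gt0// ltrD2r.
case: ifP => _; last by rewrite mule0.
rewrite -!EFinB -EFinM; congr (_%:E).
by field; rewrite gt_eqF.
Qed.

Lemma ge0_integral_affine1 (a b : R) (f : measurableTypeR R -> \bar R) : (0 < a)%R ->
  measurable_fun setT f -> (forall t, 0 <= f t) ->
  \int[lebesgue_measure]_t f (a * t + b)%R = (a^-1)%:E * \int[lebesgue_measure]_t f t.
Proof.
move=> a0 mf f0.
pose phi := (fun t => a * t + b)%R : measurableTypeR R -> measurableTypeR R.
have mphi : measurable_fun [set: measurableTypeR R] phi.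
  by apply: measurable_funD => //; exact: measurable_funM.
have -> : \int[lebesgue_measure]_t f t =
    \int[mscale (NngNum (ltW a0)) (pushm lebesgue_measure mphi)]_t f t.
  by apply: eq_measure_integral => A mA _; exact: lebesgue_measure_affine.
rewrite ge0_integral_mscale//= muleA -EFinM mulVf ?gt_eqF// mul1e.
by rewrite ge0_integral_pushforward// preimage_setT.
Qed.

End affine_change_of_variables.

Section rV_measurability.
Context {R : realType}.
Implicit Types n : nat.

Lemma measurable_funBrV n d (T : measurableType d) (f g : T -> 'rV[R]_n) :
  measurable_fun setT f -> measurable_fun setT g ->
  measurable_fun setT (fun x => f x - g x).
Proof.
move=> mf mg; apply: measurable_fun_rV => i.
rewrite (_ : _ \o _ = (fun x => rVcoord i (f x) - rVcoord i (g x))).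
  by apply: measurable_funB;
    (apply: measurableT_comp; [exact: measurable_rVcoord|]).
by apply/funext => x; rewrite /rVcoord/= !mxE.
Qed.

Lemma measurable_funDrV n d (T : measurableType d) (f g : T -> 'rV[R]_n) :
  measurable_fun setT f -> measurable_fun setT g ->
  measurable_fun setT (fun x => f x + g x).
Proof.
move=> mf mg; apply: measurable_fun_rV => i.
rewrite (_ : _ \o _ = (fun x => rVcoord i (f x) + rVcoord i (g x))).
  by apply: measurable_funD;
    (apply: measurableT_comp; [exact: measurable_rVcoord|]).
by apply/funext => x; rewrite /rVcoord/= !mxE.
Qed.

Lemma measurable_funZrV n d (T : measurableType d) (k : T -> R) (f : T -> 'rV[R]_n) :
  measurable_fun setT k -> measurable_fun setT f ->
  measurable_fun setT (fun x => k x *: f x).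
Proof.
move=> mk mf; apply: measurable_fun_rV => i.
rewrite (_ : _ \o _ = (fun x => k x * rVcoord i (f x))).
  apply: measurable_funM => //.
  by apply: measurableT_comp; [exact: measurable_rVcoord|].
by apply/funext => x; rewrite /rVcoord/= !mxE.
Qed.

Lemma measurable_enorm n : measurable_fun setT (@enorm R n).
Proof.
apply: (measurableT_comp (f := @Num.sqrt R)).
  by apply: continuous_measurable_fun; exact: sqrt_continuous.
apply: measurable_sum => i; apply: measurable_funX.
exact: (measurable_rVcoord i).
Qed.

End rV_measurability.

Section lebesgue_rV_affine.
Context {R : realType}.
Local Open Scope ereal_scope.

(** The measure in dimension [n.+1] is by construction the pushforward of a product, so Tonelli
    peels off the first coordinate. Inductions on the dimension rest on this. *)
Lemma ge0_integral_rVS n (f : 'rV[R]_n.+1 -> \bar R) :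
  measurable_fun setT f -> (forall x, 0 <= f x) ->
  \int[lebesgue_rV R n.+1]_x f x =
  \int[lebesgue_measure]_t \int[lebesgue_rV R n]_y f (rVcons (t, y)).
Proof.
move=> mf f0.
transitivity (\int[pushm (lebesgue_measure \x lebesgue_rV R n) (@measurable_rVcons R n)]_x f x).
  by apply: eq_measure_integral => A mA _.
rewrite (ge0_integral_pushforward (@measurable_rVcons R n))//.
rewrite preimage_setT fubini_tonelli1//; last by move=> z; exact: f0.
by apply: measurableT_comp => //; exact: measurable_rVcons.
Qed.

Lemma rVcons_affine n (a : R) (b : 'rV[R]_n.+1) t (y : 'rV[R]_n) :
  (a *: rVcons (t, y) + b)%R =
  rVcons ((a * t + b ord0 ord0)%R, (a *: y + \row_i b ord0 (lift ord0 i))%R).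
Proof.
apply/rowP => j.
have E i u : rVcoord i (a *: u + b)%R = (a * rVcoord i u + b ord0 i)%R.
  by rewrite /rVcoord !mxE.
rewrite -[LHS]/(rVcoord j _) E -[RHS]/(rVcoord j _).
case: (unliftP ord0 j) => [i|] ->; last by rewrite !rVcons0.
by rewrite !rVconsS /rVcoord !mxE.
Qed.

(** Induction on the dimension: the inner integral gives [a ^- n] with the tail of [b] as
    translation, and the first coordinate gives one more factor [a^-1]. *)
Lemma ge0_integral_affine n (a : R) (b : 'rV[R]_n) (f : 'rV[R]_n -> \bar R) :
  (0 < a)%R -> measurable_fun setT f -> (forall x, 0 <= f x) ->
  \int[lebesgue_rV R n]_x f (a *: x + b)%R =
  (a ^- n)%:E * \int[lebesgue_rV R n]_x f x.
Proof.
move=> a0; elim: n b f => [|n IHn] b f mf f0.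
  rewrite expr0 invr1 mul1e; apply: eq_integral => x _; congr f.
  by apply/rowP => -[].
have maff : measurable_fun setT (fun x : 'rV[R]_n.+1 => a *: x + b)%R.
  by apply: measurable_funDrV => //; exact: measurable_funZrV.
rewrite !ge0_integral_rVS//; last exact: measurableT_comp.
have mfc : measurable_fun setT (fun z => f (@rVcons R n z)).
  by apply: measurableT_comp => //; exact: measurable_rVcons.
pose F (t : measurableTypeR R) := \int[lebesgue_rV R n]_y f (rVcons (t, y)).
have mF : measurable_fun setT F.
  exact: (measurable_fun_fubini_tonelli_F (fun z => f (@rVcons R n z))).
have F0 t : 0 <= F t by exact: integral_ge0.
under eq_integral => t _.
  under eq_integral do rewrite rVcons_affine.
  rewrite (IHn _ (fun y => f (rVcons ((a * t + b ord0 ord0)%R, y))))//; last first.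
    exact: (measurableT_comp mfc (pair1_measurable _)).
  over.
rewrite -[X in _ = _ * X]/(\int[lebesgue_measure]_t F t).
transitivity (\int[lebesgue_measure]_t ((a ^- n)%:E * F (a * t + b ord0 ord0)%R)).
  by [].
have an : (0 <= a ^- n)%R by rewrite invr_ge0 exprn_ge0// ltW.
rewrite (@ge0_integralZl_EFin _ _ _ _ _ measurableT); first last.
- exact: an.
- apply: (@measurableT_comp _ _ _ _ _ _ F); first exact: mF.
  by apply: measurable_funD => //; exact: measurable_funM.
- by move=> t _; exact: F0.
rewrite (ge0_integral_affine1 _ a0 mF F0) muleA -EFinM.
by rewrite -invfM -exprSr.
Qed.

Lemma ge0_integral_shift n (b : 'rV[R]_n) (f : 'rV[R]_n -> \bar R) :
  measurable_fun setT f -> (forall x, 0 <= f x) ->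
  \int[lebesgue_rV R n]_x f (x + b)%R = \int[lebesgue_rV R n]_x f x.
Proof.
move=> mf f0.
rewrite -[RHS]mul1e -[1%E]/(1%R%:E) -[X in X%:E * _](invr1 R) -(expr1n _ n).
rewrite -(ge0_integral_affine b)//.
by under [RHS]eq_integral do rewrite scale1r.
Qed.

Lemma ge0_integral_scale n (a : R) (f : 'rV[R]_n -> \bar R) :
  (0 < a)%R -> measurable_fun setT f -> (forall x, 0 <= f x) ->
  \int[lebesgue_rV R n]_x f (a *: x)%R =
  (a ^- n)%:E * \int[lebesgue_rV R n]_x f x.
Proof.
move=> a0 mf f0; rewrite -(ge0_integral_affine 0)//.
by under [RHS]eq_integral do rewrite addr0.
Qed.

End lebesgue_rV_affine.

(** * Euclidean norm, scalar product and reflections *)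

Section euclidean_space.
Context {R : realType} {n : nat}.
Implicit Types (x y v : 'rV[R]_n) (a : R).

Definition dotrV x y : R := \sum_(i < n) x ord0 i * y ord0 i.

Lemma dotrVC x y : dotrV x y = dotrV y x.
Proof. by apply: eq_bigr => i _; rewrite mulrC. Qed.

Lemma dotrVDr x y v : dotrV v (x + y) = dotrV v x + dotrV v y.
Proof. by rewrite -big_split; apply: eq_bigr => i _; rewrite mxE mulrDr. Qed.

Lemma dotrVZr a x v : dotrV v (a *: x) = a * dotrV v x.
Proof. by rewrite mulr_sumr; apply: eq_bigr => i _; rewrite mxE mulrCA. Qed.

Lemma dotrVBr x y v : dotrV v (x - y) = dotrV v x - dotrV v y.
Proof. by rewrite dotrVDr -scaleN1r dotrVZr mulN1r. Qed.

Lemma dotrVBl x y v : dotrV (x - y) v = dotrV x v - dotrV y v.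
Proof. by rewrite dotrVC dotrVBr !(dotrVC v). Qed.

Lemma dotrVZl a x v : dotrV (a *: x) v = a * dotrV x v.
Proof. by rewrite dotrVC dotrVZr dotrVC. Qed.

Lemma dotrV_ge0 x : 0 <= dotrV x x.
Proof. by apply: sumr_ge0 => i _; rewrite -expr2 sqr_ge0. Qed.

Lemma enormE x : enorm x = Num.sqrt (dotrV x x).
Proof. by congr Num.sqrt; apply: eq_bigr => i _; rewrite expr2. Qed.

Lemma enorm_ge0 x : 0 <= enorm x. Proof. exact: sqrtr_ge0. Qed.

Lemma sqr_enorm x : enorm x ^+ 2 = dotrV x x.
Proof. by rewrite enormE sqr_sqrtr// dotrV_ge0. Qed.

Lemma enormZ a x : enorm (a *: x) = `|a| * enorm x.
Proof.
by rewrite !enormE dotrVZr dotrVZl mulrA -expr2 sqrtrM ?sqr_ge0// sqrtr_sqr.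
Qed.

Lemma enormN x : enorm (- x) = enorm x.
Proof. by rewrite -scaleN1r enormZ normrN1 mul1r. Qed.

Lemma enormBC x y : enorm (x - y) = enorm (y - x).
Proof. by rewrite -enormN opprB. Qed.

Lemma le_coord_enorm x i : `|x ord0 i| <= enorm x.
Proof.
rewrite -sqrtr_sqr ler_wsqrtr// (bigD1 i)//= lerDl.
by apply: sumr_ge0 => j _; rewrite sqr_ge0.
Qed.

Lemma enorm_eq0 x : (enorm x == 0) = (x == 0).
Proof.
apply/eqP/eqP => [x0|->].
  apply/rowP => i; rewrite mxE; apply/eqP; rewrite -normr_eq0 eq_le normr_ge0.
  by rewrite andbT -x0 le_coord_enorm.
by rewrite -(scale0r 0) enormZ normr0 mul0r.
Qed.

Lemma enorm0 : enorm (0 : 'rV[R]_n) = 0.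
Proof. by apply/eqP; rewrite enorm_eq0. Qed.

Lemma enorm_gt0 x : (0 < enorm x) = (x != 0).
Proof. by rewrite lt_def enorm_ge0 andbT enorm_eq0. Qed.

(** Cauchy-Schwarz, read off from the nonnegative square of the vector |y|^2 x - (x.y) y. *)
Lemma dotrV_le x y : dotrV x y <= enorm x * enorm y.
Proof.
have [->|y0] := eqVneq y 0.
  by rewrite enorm0 mulr0 -(scale0r 0) dotrVZr mul0r.
have yy : 0 < dotrV y y by rewrite -sqr_enorm exprn_gt0// enorm_gt0.
have := dotrV_ge0 (dotrV y y *: x - dotrV x y *: y).
rewrite !(dotrVBr, dotrVBl, dotrVZr, dotrVZl) (dotrVC y x) => h.
have : 0 <= dotrV y y * (dotrV x x * dotrV y y - dotrV x y ^+ 2).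
  by apply: le_trans h _; rewrite le_eqVlt; apply/orP; left; apply/eqP; ring.
rewrite pmulr_rge0// subr_ge0 -!sqr_enorm -exprMn => h2.
apply: le_trans (ler_norm _) _.
by rewrite -ler_sqr ?nnegrE ?mulr_ge0 ?enorm_ge0// real_normK ?num_real// mulrC exprMn mulrC -exprMn.
Qed.

Lemma ler_enormD x y : enorm (x + y) <= enorm x + enorm y.
Proof.
rewrite -ler_sqr ?nnegrE ?addr_ge0 ?enorm_ge0// sqrrD !sqr_enorm.
rewrite dotrVDr !(dotrVC (x + y)) !dotrVDr (dotrVC y x).
have := dotrV_le x y; lra.
Qed.

Lemma ler_dist_enorm x y : `|enorm x - enorm y| <= enorm (x - y).
Proof.
have h u v : enorm u - enorm v <= enorm (u - v).
  by rewrite lerBlDr -{1}(subrK v u) ler_enormD.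
by rewrite ler_norml h andbT lerNl opprB enormBC h.
Qed.

Lemma enorm_le_sum x : enorm x <= \sum_(i < n) `|x ord0 i|.
Proof.
have h (s : seq 'I_n) : \sum_(i <- s) x ord0 i ^+ 2 <= (\sum_(i <- s) `|x ord0 i|) ^+ 2.
  elim: s => [|i s IHs]; first by rewrite !big_nil expr0n.
  rewrite !big_cons sqrrD real_normK ?num_real//.
  rewrite -addrA lerD2l (le_trans IHs)// lerDr mulrn_wge0// mulr_ge0//.
  exact: sumr_ge0.
rewrite -[leRHS]ger0_norm ?sumr_ge0// -sqrtr_sqr; apply: ler_wsqrtr; exact: h.
Qed.

(** Reflections stand for the orthogonal group: one of them carries x to any y of the same norm. For
    v = 0 the formula gives the identity, which keeps the family free of side conditions. *)
Definition reflection v x := x - (2 * dotrV v x / dotrV v v) *: v.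

Lemma reflectionD v x y : reflection v (x + y) = reflection v x + reflection v y.
Proof.
rewrite /reflection dotrVDr mulrDr mulrDl scalerDl.
by rewrite opprD addrACA.
Qed.

Lemma reflectionZ v a x : reflection v (a *: x) = a *: reflection v x.
Proof.
rewrite /reflection dotrVZr scalerBr scalerA; congr (_ - _ *: _); ring.
Qed.

Lemma dotrV_reflection v x : v != 0 -> dotrV v (reflection v x) = - dotrV v x.
Proof.
move=> v0; have vv : dotrV v v != 0 by rewrite -sqr_enorm expf_neq0// enorm_eq0.
by rewrite dotrVBr dotrVZr; field.
Qed.

Lemma reflection0 x : reflection 0 x = x.
Proof. by rewrite /reflection scaler0 subr0. Qed.

Lemma reflectionK v : involutive (reflection v).
Proof.
move=> x; have [->|v0] := eqVneq v 0; first by rewrite !reflection0.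
rewrite {1}/reflection dotrV_reflection// /reflection -addrA -opprD -scalerDl.
by rewrite -mulrDl mulrN subrr mul0r scale0r subr0.
Qed.

Lemma enorm_reflection v x : enorm (reflection v x) = enorm x.
Proof.
have [->|v0] := eqVneq v 0; first by rewrite !reflection0.
have vv : dotrV v v != 0 by rewrite -sqr_enorm expf_neq0// enorm_eq0.
rewrite !enormE; congr Num.sqrt; rewrite {1}/reflection dotrVBl dotrVZl.
rewrite dotrV_reflection// dotrVBr dotrVZr (dotrVC x v); field; exact: vv.
Qed.

(** Equality of the norms gives 2 (x - y).x = |x - y|^2, so the coefficient in the reflection is
    1. *)
Lemma reflection_diff x y : enorm x = enorm y -> reflection (x - y) x = y.
Proof.
move=> xy; have [/subr0_eq->|v0] := eqVneq (x - y) 0; first by rewrite subrr reflection0.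
have vv : dotrV (x - y) (x - y) != 0 by rewrite -sqr_enorm expf_neq0// enorm_eq0.
have E : 2 * dotrV (x - y) x = dotrV (x - y) (x - y).
  rewrite !(dotrVBr, dotrVBl) -!sqr_enorm xy (dotrVC y x); ring.
by rewrite /reflection E divff// scale1r subKr.
Qed.

Lemma measurable_reflection v : measurable_fun setT (reflection v).
Proof.
apply: measurable_funBrV => //; apply: measurable_funZrV => //.
apply: measurable_funM => //; apply: measurable_funM => //.
apply: measurable_sum => i; apply: measurable_funM => //.
exact: (measurable_rVcoord i).
Qed.

End euclidean_space.

Lemma enorm_e1 (R : realType) n : (0 < n)%N -> enorm (e1 n : 'rV[R]_n) = 1.
Proof.
case: n => // n _; rewrite /enorm big_ord_recl !mxE/= expr1n big1 ?addr0 ?sqrtr1// => i _.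
by rewrite !mxE/= expr0n.
Qed.

(** * Invariance of Lebesgue measure under linear isometries *)

Section isometry_invariance.
Context {R : realType} {n : nat}.
Local Notation L := (lebesgue_rV R n).
Implicit Types (x y v : 'rV[R]_n) (a : R).
Local Open Scope ereal_scope.

Definition ball1 : set 'rV[R]_n := [set x | (enorm x < 1)%R].

Lemma measurable_ball1 : measurable ball1.
Proof.
rewrite -[X in measurable X]setTI.
have := measurable_fun_ltr (@measurable_enorm R n) (measurable_cst (1 : R)%R).
by move=> /(_ measurableT [set true]); apply.
Qed.

Definition cube (a b : R) : set 'rV[R]_n :=
  [set x | forall i, (`[a, b]%classic : set (measurableTypeR R)) (x ord0 i)].

Lemma lebesgue_rV_cube (a b : R) : (a <= b)%R ->
  L (cube a b) = ((b - a) ^+ n)%:E.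
Proof.
move=> ab.
rewrite (@lebesgue_rV_box R n (fun=> `[a, b]%classic)); last by move=> i; exact: measurable_itv.
rewrite big_const_ord lebesgue_measure_itv/= lte_fin.
have -> : (if (a < b)%R then (b%:E - a%:E) else 0) = (b - a)%:E.
  by case: ltP => // ba; congr (_%:E); apply/esym/eqP; rewrite subr_eq0 eq_le ba ab.
by elim: n => [|m IHm] //=; rewrite IHm -EFinM exprS.
Qed.

Lemma measurable_cube (a b : R) :
  measurable (cube a b).
Proof.
by apply: (@measurable_rVbox R n (fun=> `[a, b]%classic)) => i; exact: measurable_itv.
Qed.

Lemma ball1_gt0 : 0 < L ball1.
Proof.
have n0 : (0 < n.+1%:R :> R)%R by [].
(* The side 1/(n+1), rather than 1/n, makes the sum of the coordinates at most n/(n+1), strictly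
   below 1. *)
apply: (@lt_le_trans _ _ (L (cube 0 n.+1%:R^-1))).
  by rewrite lebesgue_rV_cube ?invr_ge0// subr0 lte_fin exprn_gt0// invr_gt0.
apply: le_measure; rewrite ?inE; [exact: measurable_cube|exact: measurable_ball1|].
move=> x /= hx; apply: le_lt_trans (enorm_le_sum x) _.
apply: (@le_lt_trans _ _ (\sum_(i < n) n.+1%:R^-1)%R).
  apply: ler_sum => i _; have /= := hx i; rewrite in_itv/= => /andP[x0 x1].
  by rewrite ger0_norm.
by rewrite sumr_const card_ord -[X in (X < _)%R]mulr_natl ltr_pdivrMr// mul1r ltr_nat.
Qed.

Lemma ball1_fin : L ball1 < +oo.
Proof.
apply: (@le_lt_trans _ _ (L (cube (- 1) 1))).
  apply: le_measure; rewrite ?inE; [exact: measurable_ball1|exact: measurable_cube|].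
  move=> x /= hx i; rewrite /= in_itv/= -ler_norml.
  exact: le_trans (le_coord_enorm x i) (ltW hx).
by rewrite lebesgue_rV_cube ?ltry// lerN10.
Qed.

(* With b the indicator of the unit ball B, Tonelli and translation invariance
   turn the double integral of f (Q x) b(y), which is |B| int (f o Q), into that
   of f(y) b(x), which is |B| int f. *)
Lemma ge0_integral_isometry (Q : 'rV[R]_n -> 'rV[R]_n) (f : 'rV[R]_n -> \bar R) :
  measurable_fun setT Q -> {morph Q : x y / (x + y)%R} -> involutive Q ->
  (forall x, enorm (Q x) = enorm x) ->
  measurable_fun setT f -> (forall x, 0 <= f x) ->
  \int[L]_x f (Q x) = \int[L]_x f x.
Proof.
move=> mQ QD QK Qnorm mf f0.
pose b x : \bar R := (\1_ball1 x)%:E.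
have mb : measurable_fun setT b.
  by apply/measurable_EFinP; apply: measurable_indic; exact: measurable_ball1.
have b0 x : 0 <= b x by rewrite lee_fin indicE.
have bE : \int[L]_x b x = L ball1.
  by rewrite integral_indic ?setIT//; exact: measurable_ball1.
have bN x : b (- Q x)%R = b x.
  rewrite /b !indicE; suff -> : ((- Q x)%R \in ball1) = (x \in ball1) by [].
  by apply/idP/idP; rewrite !inE /ball1/= enormN Qnorm.
have mfQ : measurable_fun setT (fun x => f (Q x)) by exact: measurableT_comp.
have E1 : \int[L]_x \int[L]_y (f (Q x) * b y) = \int[L]_x f (Q x) * L ball1.
  rewrite -bE -ge0_integralZr//; last exact: integral_ge0.
  by apply: eq_integral => x _; rewrite ge0_integralZl.
have E2 : \int[L]_x \int[L]_y (f (Q x) * b y) =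
    \int[L]_x \int[L]_y (f (Q x) * b (y - Q x)%R).
  apply: eq_integral => x _.
  rewrite (ge0_integral_shift (- Q x)%R (f := fun y => f (Q x) * b y))//.
    exact: measurable_funeM.
  by move=> y; exact: mule_ge0.
have E3 : \int[L]_x \int[L]_y (f (Q x) * b (y - Q x)%R) =
    \int[L]_y \int[L]_x (f (Q x) * b (y - Q x)%R).
  apply: (fubini_tonelli (fun z : 'rV[R]_n * 'rV[R]_n => f (Q z.1) * b (z.2 - Q z.1)%R)).
    apply: emeasurable_funM.
      by apply: (measurableT_comp mfQ); exact: measurable_fst.
    apply: (measurableT_comp mb); apply: measurable_funBrV.
      exact: measurable_snd.
    by apply: (measurableT_comp mQ); exact: measurable_fst.
  by move=> z; exact: mule_ge0.
(* Substitute x + Q y for x: since Q is an additive involution, Q x becomes Q x + y and y - Q x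
   becomes - Q x, where [b] has the same value as at x. *)
have E4 : \int[L]_y \int[L]_x (f (Q x) * b (y - Q x)%R) =
    \int[L]_y \int[L]_x (f (Q x + y)%R * b x).
  apply: eq_integral => y _.
  rewrite -(ge0_integral_shift (Q y) (f := fun x => f (Q x) * b (y - Q x)%R)).
  - by apply: eq_integral => x _; rewrite QD QK opprD addrCA subrr addr0 bN.
  - apply: emeasurable_funM; first exact: mfQ.
    by apply: (measurableT_comp mb); apply: measurable_funBrV; [exact: measurable_cst|exact: mQ].
  - by move=> x; exact: mule_ge0.
have E5 : \int[L]_y \int[L]_x (f (Q x + y)%R * b x) =
    \int[L]_x \int[L]_y (f (y + Q x)%R * b x).
  transitivity (\int[L]_x \int[L]_y (f (Q x + y)%R * b x)).
    apply: (fubini_tonelli (fun z : 'rV[R]_n * 'rV[R]_n => f (Q z.2 + z.1)%R * b z.2)); last first.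
      by move=> z; exact: mule_ge0.
    apply: emeasurable_funM.
      apply: (measurableT_comp mf); apply: measurable_funDrV.
        by apply: (measurableT_comp mQ); exact: measurable_snd.
      exact: measurable_fst.
    by apply: (measurableT_comp mb); exact: measurable_snd.
  by apply: eq_integral => x _; apply: eq_integral => y _; rewrite addrC.
have E6 : \int[L]_x \int[L]_y (f (y + Q x)%R * b x) = \int[L]_x f x * L ball1.
  transitivity (\int[L]_x (\int[L]_y f y * b x)).
    apply: eq_integral => x _.
    rewrite ge0_integralZr; first by rewrite ge0_integral_shift.
    - exact: measurableT.
    - by apply: (measurableT_comp mf); apply: measurable_funDrV; [exact: measurable_id|exact: measurable_cst].
    - by move=> y _; exact: f0.
    - exact: b0.
  rewrite (ge0_integralZl L measurableT mb); first by rewrite bE.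
    by move=> x _; exact: b0.
  by apply: integral_ge0 => y _; exact: f0.
have : \int[L]_x f (Q x) * L ball1 = \int[L]_x f x * L ball1.
  by rewrite -E1 E2 E3 E4 E5 E6.
have [r rE] : exists r : R, L ball1 = r%:E.
  exists (fine (L ball1)).
  have h0 : 0 <= L ball1 by exact: measure_ge0.
  have hf : L ball1 \is a fin_num.
    rewrite ge0_fin_numE.
    exact: ball1_fin.
    exact: h0.
  apply/esym.
  apply: fineK.
  exact: hf.
have r0 : (0 < r)%R by rewrite -lte_fin -rE ball1_gt0.
have rr : r%:E * (r^-1)%:E = 1 by rewrite -EFinM mulfV ?gt_eqF.
rewrite rE => /(congr1 (fun u => u * (r^-1)%:E)).
by rewrite -!muleA rr !mule1.
Qed.

Lemma ge0_integral_reflection v (f : 'rV[R]_n -> \bar R) :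
  measurable_fun setT f -> (forall x, 0 <= f x) ->
  \int[L]_x f (reflection v x) = \int[L]_x f x.
Proof.
apply: ge0_integral_isometry; [exact: measurable_reflection|exact: reflectionD|
  exact: reflectionK|exact: enorm_reflection].
Qed.

End isometry_invariance.

Lemma le0_ler_powR (R : realType) (r a b : R) :
  r <= 0 -> 0 < a -> a <= b -> b `^ r <= a `^ r.
Proof.
move=> r0 a0 ab; rewrite -(opprK r) !(powRN _ (- r)) lef_pV2 ?posrE ?powR_gt0//.
  by apply: ge0_ler_powR; rewrite ?oppr_ge0 ?nnegrE// ltW// (lt_le_trans a0).
exact: lt_le_trans ab.
Qed.

Lemma measurable_funPowR (R : realType) d (T : measurableType d) (f : T -> R) (r : R) :
  measurable_fun setT f -> measurable_fun setT (fun x => f x `^ r).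
Proof.
by move=> mf; apply: (measurableT_comp (f := fun t => t `^ r)) => //; exact: measurable_powR.
Qed.

(** * Integrability of powers of the norm near 0 and at infinity *)

Section power_integrals.
Context {R : realType} {n : nat}.
Local Notation L := (lebesgue_rV R n).
Implicit Types (x y v : 'rV[R]_n) (a b r : R).

(** The exponent is written [b - n%:R] so that dilating an annulus by rho multiplies the integral by
    rho^b: b > 0 is integrability at 0 and b < 0 integrability at infinity. *)
Definition truncated_power b (A : set R) x : R :=
  enorm x `^ (b - n%:R) * \1_A (enorm x).

Lemma truncated_power_ge0 b A x : 0 <= truncated_power b A x.
Proof. by rewrite mulr_ge0 ?powR_ge0// indicE. Qed.

Lemma measurable_truncated_power b (A : set (measurableTypeR R)) :
  measurable A -> measurable_fun setT (truncated_power b A).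
Proof.
move=> mA; apply: measurable_funM.
  by apply: measurable_funPowR; exact: measurable_enorm.
apply: (measurableT_comp (f := \1_A : R -> R)); last exact: measurable_enorm.
exact: measurable_indic.
Qed.

Lemma integral_annulus_fin b r : 0 < r ->
  (\int[L]_x (truncated_power b `[r, 2 * r] x)%:E < +oo)%E.
Proof.
(* The sum of the two endpoint values dominates the power on [r, 2r] whatever the sign of the
   exponent. *)
move=> r0; pose C := (2 * r) `^ (b - n%:R) + r `^ (b - n%:R).
have C0 : 0 <= C by rewrite addr_ge0// powR_ge0.
apply: (@le_lt_trans _ _ (\int[L]_x (C * \1_(cube (- (2 * r)) (2 * r)) x)%:E)%E).
  apply: ge0_le_integral.
  - exact: measurableT.
  - by move=> x _; rewrite lee_fin truncated_power_ge0.
  - by apply/measurable_EFinP; apply: measurable_truncated_power; exact: measurable_itv.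
  - apply/measurable_EFinP; apply: measurable_funM; first exact: measurable_cst.
    by apply: measurable_indic; exact: measurable_cube.
  move=> x _; rewrite lee_fin /truncated_power !indicE.
  case: (boolP (enorm x \in _)) => [|_]; last by rewrite mulr0 mulr_ge0.
  rewrite inE/= in_itv/= => /andP[rx x2r]; rewrite mulr1 mem_set ?mulr1.
    have x0 : 0 < enorm x by exact: lt_le_trans rx.
    have [e0|e0] := leP 0 (b - n%:R).
      apply: ler_wpDr; first exact: powR_ge0.
      by apply: ge0_ler_powR; rewrite ?nnegrE// ltW// (lt_le_trans x0).
    by apply: ler_wpDl; [exact: powR_ge0|apply: le0_ler_powR => //; exact: ltW].
  move=> i; rewrite /= in_itv/= -ler_norml.
  exact: le_trans (le_coord_enorm x i) x2r.
under eq_integral do rewrite EFinM.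
rewrite (ge0_integralZl_EFin _ measurableT); last exact: C0.
- rewrite integral_indic ?setIT; [|exact: measurableT|exact: measurable_cube].
  rewrite -[X in (_ * X)%E]/(lebesgue_rV R n (cube (- (2 * r)) (2 * r))).
  rewrite lebesgue_rV_cube; first exact: ltry.
  by rewrite -subr_ge0 opprK addr_ge0// mulr_ge0// ltW.
- by move=> x _; rewrite lee_fin indicE.
- by apply/measurable_EFinP; apply: measurable_indic; exact: measurable_cube.
Qed.

(* By scaling, the integrals over the annuli of inner radius rho^k r form a
   geometric series of ratio rho^b. *)
Lemma integral_dyadic_fin b r (rho : R) (f : 'rV[R]_n -> R) :
  0 < r -> 0 < rho -> rho `^ b < 1 ->
  measurable_fun setT f -> (forall x, 0 <= f x) ->
  (forall x, f x != 0 -> exists k, f x <= truncated_power b `[rho ^+ k * r, rho ^+ k * (2 * r)] x) ->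
  (\int[L]_x (f x)%:E < +oo)%E.
Proof.
move=> r0 rho0 rhob mf f0 fle.
pose g k x := truncated_power b `[rho ^+ k * r, rho ^+ k * (2 * r)] x.
have mg k : measurable_fun setT (fun x => (g k x)%:E).
  by apply/measurable_EFinP; apply: measurable_truncated_power; exact: measurable_itv.
have g0 k x : (0 <= (g k x)%:E)%E by rewrite lee_fin truncated_power_ge0.
have [I IE] : exists I : R, (\int[L]_x (g 0%N x)%:E = I%:E)%E.
  have hI : (\int[L]_x (g 0%N x)%:E < +oo)%E.
    by rewrite /g expr0 !mul1r; exact: integral_annulus_fin.
  have h0 : (0 <= \int[L]_x (g 0%N x)%:E)%E by apply: integral_ge0 => x _; exact: g0.
  exists (fine (\int[L]_x (g 0%N x)%:E)%E); apply/esym; apply: fineK.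
  by rewrite ge0_fin_numE.
have I0 : 0 <= I by rewrite -lee_fin -IE; apply: integral_ge0 => x _; exact: g0.
have gE k : (\int[L]_x (g k x)%:E = ((rho `^ b) ^+ k * I)%:E)%E.
  have rk : 0 < rho ^+ k by exact: exprn_gt0.
  have rkV : 0 < (rho ^+ k)^-1 by rewrite invr_gt0.
  transitivity (\int[L]_x ((rho ^+ k) `^ (b - n%:R) * g 0%N ((rho ^+ k)^-1 *: x))%:E)%E.
    apply: eq_integral => x _; congr EFin; rewrite /g /truncated_power enormZ.
    rewrite (gtr0_norm rkV) [RHS]mulrA; congr (_ * _).
      rewrite -powRM; [|exact: ltW|by rewrite mulr_ge0 ?enorm_ge0// ltW].
      by rewrite mulVKf// gt_eqF.
    rewrite !indicE; congr (_%:R); congr nat_of_bool; apply/idP/idP; rewrite !inE/= !in_itv/= expr0 !mul1r.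
      by move=> /andP[h1 h2]; rewrite mulrC ler_pdivlMr// ler_pdivrMr// mulrC h1 mulrC h2.
    by rewrite mulrC ler_pdivlMr// ler_pdivrMr// mulrC => /andP[-> h2]; rewrite mulrC.
  under eq_integral do rewrite EFinM.
  rewrite (ge0_integralZl_EFin _ measurableT); last exact: powR_ge0.
  - rewrite (@ge0_integral_scale _ n _ (fun x => (g 0%N x)%:E) rkV (mg 0%N) (g0 0%N)) IE.
    congr EFin.
    rewrite exprVn invrK mulrA; congr (_ * _).
    rewrite -(powR_mulrn n (ltW rk)) -powRD ?subrK; last first.
      by rewrite (gt_eqF rk) implybT.
    by rewrite -powR_mulrn ?ltW// -powRrM -powR_mulrn ?powR_ge0// -powRrM mulrC.
  - by move=> x _; exact: g0.
  - apply: (measurableT_comp (mg 0%N)).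
    by apply: measurable_funZrV; [exact: measurable_cst|exact: measurable_id].
apply: (@le_lt_trans _ _ (\int[L]_x \sum_(0 <= k <oo) (g k x)%:E)%E).
  apply: ge0_le_integral.
  - exact: measurableT.
  - by move=> x _; rewrite lee_fin.
  - exact/measurable_EFinP.
  - by apply: ge0_emeasurable_sum => k *; [exact: g0|exact: mg].
  move=> x _; have [->|fx] := eqVneq (f x) 0.
    by apply: nneseries_ge0 => k _ _; exact: g0.
  have [k fk] := fle _ fx.
  apply: (@le_trans _ _ (g k x)%:E); first by rewrite lee_fin.
  apply: le_trans (@nneseries_lim_ge R (fun k => (g k x)%:E) xpredT 0%N k.+1 _).
    rewrite big_nat_recr//= leeDr// sume_ge0// => *; exact: g0.
  by move=> i _ _; exact: g0.
rewrite integral_nneseries; [|exact: measurableT|exact: mg|by move=> *; exact: g0].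
apply: (@le_lt_trans _ _ ((1 - rho `^ b)^-1 * I)%:E); last exact: ltry.
have q0 : 0 <= rho `^ b by exact: powR_ge0.
apply: lime_le.
  by apply: is_cvg_nneseries => k _ _; apply: integral_ge0 => x _; exact: g0.
apply: nearW => N; under eq_bigr do rewrite gE.
rewrite sumEFin lee_fin -mulr_suml ler_wpM2r// big_mkord.
rewrite -[leRHS]mul1r ler_pdivlMr ?subr_gt0//.
have -> : (\sum_(i < N) (rho `^ b) ^+ i) * (1 - rho `^ b) = 1 - (rho `^ b) ^+ N.
  by rewrite mulrC -opprB mulNr -subrX1 opprB.
by rewrite gerBl exprn_ge0.
Qed.

Lemma dyadic_exists (t : R) : 1 <= t -> exists k, 2 ^+ k <= t <= 2 ^+ k * 2.
Proof.
move=> t1; have [m tm] : exists m, t <= 2 ^+ m.+1.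
  exists (Num.bound t); apply: ltW; apply: (lt_le_trans (archi_boundP (le_trans ler01 t1))).
  by rewrite -natrX ler_nat ltnW// (leq_trans (ltn_expl _ (isT : (1 < 2)%N)))// leq_pexp2l.
elim: m tm => [|m IHm] tm; first by exists 0%N; rewrite expr0 t1 mul1r.
have [/IHm//|mt] := leP t (2 ^+ m.+1).
by exists m.+1; rewrite (ltW mt) -exprSr.
Qed.

Lemma integral_near_fin a r : 0 < a -> 0 < r ->
  (\int[L]_x (truncated_power a `]0, r] x)%:E < +oo)%E.
Proof.
move=> a0 r0; have h2 : 0 < 2^-1 :> R by rewrite invr_gt0.
(* The annuli with radii 2^-k r/2 and 2^-k r fill the punctured ball of radius r, and the ratio
   (1/2)^a is below 1 because a > 0. *)
apply: (@integral_dyadic_fin a (r / 2) 2^-1) => //.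
- by rewrite divr_gt0.
- have := @gt0_ltr_powR R a a0 2^-1 1; rewrite powR1; apply.
  + by rewrite nnegrE invr_ge0.
  + by rewrite nnegrE.
  + by rewrite invf_lt1// ltr1n.
- by apply: measurable_truncated_power; exact: measurable_itv.
- exact: truncated_power_ge0.
move=> x; rewrite /truncated_power !indicE.
case: (boolP (enorm x \in _)) => [|_]; last by rewrite mulr0 eqxx.
rewrite inE/= in_itv/= => /andP[x0 xr] _.
have [|k /andP[k1 k2]] := @dyadic_exists (r / enorm x).
  by rewrite ler_pdivlMr// mul1r.
exists k; rewrite indicE mem_set//= in_itv/=.
have k0 : 0 < 2 ^+ k :> R by exact: exprn_gt0.
rewrite exprVn; apply/andP; split.
  by move: k2; rewrite ler_pdivrMr// ler_pdivrMl// ler_pdivrMr// mulrAC.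
by move: k1; rewrite ler_pdivlMr// (mulrCA 2) mulfV// mulr1 ler_pdivlMl.
Qed.

Lemma integral_far_fin a r : 0 < a -> 0 < r ->
  (\int[L]_x (truncated_power (- a) `[r, +oo[ x)%:E < +oo)%E.
Proof.
move=> a0 r0.
apply: (@integral_dyadic_fin (- a) r 2) => //.
- rewrite powRN invf_lt1 ?powR_gt0//.
  by have := @gt0_ltr_powR R a a0 1 2; rewrite powR1; apply; rewrite ?nnegrE ?ltr1n.
- by apply: measurable_truncated_power; exact: measurable_itv.
- exact: truncated_power_ge0.
move=> x; rewrite /truncated_power !indicE.
case: (boolP (enorm x \in _)) => [|_]; last by rewrite mulr0 eqxx.
rewrite inE/= in_itv/= andbT => rx _.
have [|k /andP[k1 k2]] := @dyadic_exists (enorm x / r).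
  by rewrite ler_pdivlMr// mul1r.
exists k; rewrite indicE mem_set//= in_itv/=.
by move: k1 k2; rewrite ler_pdivlMr// ler_pdivrMr// -mulrA => -> ->.
Qed.

End power_integrals.

Section integral_transfer.
Context d {T : measurableType d} {R : realType} (mu : {measure set T -> \bar R}).
Local Open Scope ereal_scope.

(** Positive and negative parts carry a change of variables from nonnegative to integrable
    functions; it serves similarities, dilations of pairs and the exchange of the two variables.
    Finiteness of both parts is what lets the factor distribute over their difference. *)
Lemma integral_transfer (S : T -> T) (c : R) (f : T -> R) :
  (forall g : T -> \bar R, measurable_fun setT g -> (forall x, 0 <= g x) ->
    \int[mu]_x g (S x) = c%:E * \int[mu]_x g x) ->
  mu.-integrable setT (EFin \o f) ->
  \int[mu]_x (f (S x))%:E = c%:E * \int[mu]_x (f x)%:E.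
Proof.
move=> H fint; have mf := measurable_int mu fint.
rewrite integralE [in RHS]integralE.
pose F := EFin \o f.
have -> : \int[mu]_x (fun x => (f (S x))%:E)^\+ x = \int[mu]_x F^\+ (S x).
  by apply: eq_integral => x _; rewrite !funeposE.
have -> : \int[mu]_x (fun x => (f (S x))%:E)^\- x = \int[mu]_x F^\- (S x).
  by apply: eq_integral => x _; rewrite !funenegE.
rewrite (H F^\+); [|exact: measurable_funepos|exact: funepos_ge0].
rewrite (H F^\-); [|exact: measurable_funeneg|exact: funeneg_ge0].
have Ip : \int[mu]_x F^\+ x \is a fin_num by exact: integrable_pos_fin_num.
have In : \int[mu]_x F^\- x \is a fin_num by exact: integrable_neg_fin_num.
apply/esym; apply: muleBr; [by []|exact: fin_num_adde_defr].
Qed.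

Lemma integrable_EFinP (f : T -> R) : measurable_fun setT f ->
  \int[mu]_x (`|f x|%R)%:E < +oo -> mu.-integrable setT (EFin \o f).
Proof. by move=> mf h; apply/integrableP; split => //; exact/measurable_EFinP. Qed.

Lemma le_integral_fin (f g : T -> R) : measurable_fun setT f ->
  measurable_fun setT g -> (forall x, 0 <= f x <= g x)%R ->
  \int[mu]_x (g x)%:E < +oo -> \int[mu]_x (f x)%:E < +oo.
Proof.
move=> mf mg fg; apply: le_lt_trans; apply: ge0_le_integral.
- exact: measurableT.
- by move=> x _; rewrite lee_fin; case/andP: (fg x).
- exact/measurable_EFinP.
- exact/measurable_EFinP.
- by move=> x _; rewrite lee_fin; case/andP: (fg x).
Qed.

Lemma ge0_integral_fin_numP (f : T -> R) : (forall x, 0 <= f x)%R ->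
  \int[mu]_x (f x)%:E < +oo -> exists2 r : R, (0 <= r)%R & \int[mu]_x (f x)%:E = r%:E.
Proof.
move=> f0 foo; have i0 : 0 <= \int[mu]_x (f x)%:E.
  by apply: integral_ge0 => x _; rewrite lee_fin.
have ifin : \int[mu]_x (f x)%:E \is a fin_num by rewrite ge0_fin_numE.
exists (fine (\int[mu]_x (f x)%:E)); first exact: fine_ge0.
by apply/esym; apply: fineK.
Qed.

Lemma integrable_fin_numP (f : T -> R) : mu.-integrable setT (EFin \o f) ->
  exists r : R, \int[mu]_x (f x)%:E = r%:E.
Proof.
move=> fint; have ifin := integrable_fin_num measurableT fint.
by exists (fine (\int[mu]_x (f x)%:E)); apply/esym; apply: fineK.
Qed.

Lemma ge0_integralZ_fin (f : T -> R) (c : R) : measurable_fun setT f ->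
  (forall x, 0 <= f x)%R -> (0 <= c)%R ->
  \int[mu]_x (f x)%:E < +oo -> \int[mu]_x (c * f x)%:E < +oo.
Proof.
move=> mf f0 c0 foo; have [r r0 rE] := ge0_integral_fin_numP f0 foo.
under eq_integral do rewrite EFinM.
rewrite (ge0_integralZl_EFin _ measurableT); last exact: c0.
- by rewrite rE; exact: ltry.
- by move=> x _; rewrite lee_fin.
- exact/measurable_EFinP.
Qed.

Lemma ge0_integralD_fin (f g : T -> R) : measurable_fun setT f ->
  measurable_fun setT g -> (forall x, 0 <= f x)%R -> (forall x, 0 <= g x)%R ->
  \int[mu]_x (f x)%:E < +oo -> \int[mu]_x (g x)%:E < +oo ->
  \int[mu]_x (f x + g x)%:E < +oo.
Proof.
move=> mf mg f0 g0 foo goo.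
under eq_integral do rewrite EFinD.
rewrite ge0_integralD.
- exact: lte_add_pinfty.
- exact: measurableT.
- by move=> x _; rewrite lee_fin.
- exact/measurable_EFinP.
- by move=> x _; rewrite lee_fin.
- exact/measurable_EFinP.
Qed.

End integral_transfer.

(** * Integrals of kernels homogeneous under similarities *)

Section homogeneous_integrals.
Context {R : realType} {n : nat} (n0 : (0 < n)%N).
Local Notation L := (lebesgue_rV R n).
Local Notation V := 'rV[R]_n.
Implicit Types (x y v : V) (a m : R) (G : V -> V -> R).

Definition similarity_homogeneous m G :=
  (forall a x y, 0 < a -> G (a *: x) (a *: y) = a `^ m * G x y) /\
  (forall v x y, G (reflection v x) (reflection v y) = G x y).

(** Similarities act transitively on nonzero vectors: the reflection along e1 - x/|x| sends e1 to
    the unit vector x/|x|. *)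
Lemma similarity_e1 x : x != 0 ->
  exists v, x = enorm x *: reflection v (e1 n).
Proof.
move=> x0; have nx : 0 < enorm x by rewrite enorm_gt0.
exists (e1 n - (enorm x)^-1 *: x); rewrite reflection_diff.
  by rewrite scalerA mulfV ?gt_eqF// scale1r.
by rewrite enorm_e1// enormZ gtr0_norm ?invr_gt0// mulVf// gt_eqF.
Qed.

Lemma ge0_integral_similarity v a (f : V -> \bar R) : 0 < a ->
  measurable_fun setT f -> (forall x, 0 <= f x)%E ->
  (\int[L]_x f (a *: reflection v x) = (a ^- n)%:E * \int[L]_x f x)%E.
Proof.
move=> a0 mf f0.
rewrite (@ge0_integral_reflection R n v (fun x => f (a *: x))).
- exact: ge0_integral_scale.
- apply: (measurableT_comp mf).
  by apply: measurable_funZrV; [exact: measurable_cst|exact: measurable_id].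
- by move=> x; exact: f0.
Qed.

(** The similarity that carries e1 to x moves the base point of the integral to e1; the kernel
    contributes degree [m] and the Jacobian degree n. *)
Lemma ge0_integral_homogeneous m G x : similarity_homogeneous m G ->
  (forall x, measurable_fun setT (G x)) -> (forall x y, 0 <= G x y) -> x != 0 ->
  (\int[L]_y (G x y)%:E = (enorm x `^ (m + n%:R))%:E * \int[L]_y (G (e1 n) y)%:E)%E.
Proof.
move=> [Ga Gv] mG G0 x0; have nx : 0 < enorm x by rewrite enorm_gt0.
have [v xE] := similarity_e1 x0; set a := enorm x in nx xE *.
have mGx z : measurable_fun setT (fun y => (G z y)%:E) by exact/measurable_EFinP.
have mGx0 z y : (0 <= (G z y)%:E)%E by rewrite lee_fin.
have := ge0_integral_similarity v nx (mGx x) (mGx0 x).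
have -> : (\int[L]_y (G x (a *: reflection v y))%:E =
    (a `^ m)%:E * \int[L]_y (G (e1 n) y)%:E)%E.
  under eq_integral do rewrite {1}xE Ga// Gv EFinM.
  rewrite (ge0_integralZl_EFin _ measurableT) => //; exact: powR_ge0.
move=> /(congr1 (fun u => (a ^+ n)%:E * u)%E); rewrite !muleA.
have -> : ((a ^+ n)%:E * (a ^- n)%:E = 1 :> \bar R)%E.
  by rewrite -EFinM mulfV// expf_neq0// gt_eqF.
rewrite mul1e => <-; congr (_ * _)%E; rewrite -EFinM; congr EFin.
by rewrite powRD ?(gt_eqF nx) ?implybT// powR_mulrn ?ltW// mulrC.
Qed.

Lemma integral_homogeneous m G x : similarity_homogeneous m G ->
  (forall x, L.-integrable setT (EFin \o G x)) -> x != 0 ->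
  (\int[L]_y (G x y)%:E = (enorm x `^ (m + n%:R))%:E * \int[L]_y (G (e1 n) y)%:E)%E.
Proof.
move=> [Ga Gv] iG x0; have nx : 0 < enorm x by rewrite enorm_gt0.
have [v xE] := similarity_e1 x0; set a := enorm x in nx xE *.
have := @integral_transfer _ _ _ L (fun y => a *: reflection v y) (a ^- n) (G x)
  (fun g mg g0 => ge0_integral_similarity v nx mg g0) (iG x).
have -> : (\int[L]_y (G x (a *: reflection v y))%:E =
    (a `^ m)%:E * \int[L]_y (G (e1 n) y)%:E)%E.
  under eq_integral do rewrite {1}xE Ga// Gv EFinM.
  exact: (integralZl measurableT (iG (e1 n))).
move=> /(congr1 (fun u => (a ^+ n)%:E * u)%E); rewrite !muleA.
have -> : ((a ^+ n)%:E * (a ^- n)%:E = 1 :> \bar R)%E.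
  by rewrite -EFinM mulfV// expf_neq0// gt_eqF.
rewrite mul1e => <-; congr (_ * _)%E; rewrite -EFinM; congr EFin.
by rewrite powRD ?(gt_eqF nx) ?implybT// powR_mulrn ?ltW// mulrC.
Qed.

Lemma ge0_integral2_scale a (F : V * V -> \bar R) : 0 < a ->
  measurable_fun setT F -> (forall z, 0 <= F z)%E ->
  (\int[L \x L]_z F (a *: z.1, a *: z.2) =
   (a `^ (- (2 * n%:R)))%:E * \int[L \x L]_z F z)%E.
Proof.
move=> a0 mF F0.
have ms : measurable_fun setT (fun z : V * V => (a *: z.1, a *: z.2)).
  apply: measurable_fun_pair; apply: measurable_funZrV; try exact: measurable_cst.
    exact: measurable_fst.
  exact: measurable_snd.
rewrite (fubini_tonelli1 (fun z : V * V => F (a *: z.1, a *: z.2))); first last.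
- by move=> z; exact: F0.
- exact: (measurableT_comp mF ms).
rewrite (fubini_tonelli1 F) //.
pose h x : \bar R := (\int[L]_y F (x, y))%E.
have mh : measurable_fun setT h by exact: (measurable_fun_fubini_tonelli_F F).
have h0 x : (0 <= h x)%E by apply: integral_ge0 => y _; exact: F0.
have an : 0 <= a ^- n by rewrite invr_ge0 exprn_ge0// ltW.
transitivity (\int[L]_x ((a ^- n)%:E * h (a *: x)))%E.
  apply: eq_integral => x _; rewrite /fubini_F/=.
  apply: (@ge0_integral_scale R n a (fun y => F (a *: x, y))) => //.
  exact: (measurableT_comp mF (pair1_measurable _)).
rewrite (ge0_integralZl_EFin _ measurableT); last exact: an.
- rewrite (ge0_integral_scale a0 mh h0) muleA; congr (_ * _)%E.
  rewrite -EFinM; congr EFin; rewrite powRN -natrM powR_mulrn ?ltW//.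
  by rewrite mulSn mul1n exprD invfM.
- by move=> x _; exact: h0.
- apply: (measurableT_comp mh).
  by apply: measurable_funZrV; [exact: measurable_cst|exact: measurable_id].
Qed.

Lemma integral2_scale a (F : V * V -> R) : 0 < a ->
  (L \x L)%E.-integrable setT (EFin \o F) ->
  (\int[L \x L]_z (F (a *: z.1, a *: z.2))%:E =
   (a `^ (- (2 * n%:R)))%:E * \int[L \x L]_z (F z)%:E)%E.
Proof.
move=> a0 iF; apply: (@integral_transfer _ _ _ (L \x L)%E (fun z : V * V => (a *: z.1, a *: z.2))) => // g mg g0.
exact: ge0_integral2_scale.
Qed.

Lemma integral2_swap (F : V * V -> R) : (L \x L)%E.-integrable setT (EFin \o F) ->
  (\int[L \x L]_z (F (z.2, z.1))%:E = \int[L \x L]_z (F z)%:E)%E.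
Proof.
have H (g : V * V -> \bar R) : measurable_fun setT g -> (forall z, 0 <= g z)%E ->
  (\int[L \x L]_z g (z.2, z.1) = 1%:E * \int[L \x L]_z g z)%E.
  move=> mg g0; rewrite mul1e.
  rewrite (fubini_tonelli1 (fun z : V * V => g (z.2, z.1))); first last.
  - by move=> z; exact: g0.
  - apply: (measurableT_comp mg); exact: measurable_swap.
  by rewrite (fubini_tonelli2 g).
move=> iF; have := @integral_transfer _ _ _ (L \x L)%E (fun z : V * V => (z.2, z.1)) 1 F H iF.
by rewrite mul1e.
Qed.

End homogeneous_integrals.

(** * Antisymmetric homogeneous kernels *)

Section antisymmetric_kernel.
Context {R : realType} {n : nat} (n0 : (0 < n)%N).
Local Notation L := (lebesgue_rV R n).
Local Notation V := 'rV[R]_n.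
Implicit Types (x y v : V) (phi psi g : V -> R).
(** [Kint] is the only analytic assumption, and homogeneity spreads it from e1 to every nonzero base
    point. Homogeneity gives no control at the base point 0, where [K0] fixes the value on a null
    set. *)
Variables (K : V -> V -> R) (eta : R).
Hypothesis eta01 : 0 < eta < 1.
Hypothesis mK : measurable_fun setT (fun z : V * V => K z.1 z.2).
Hypothesis KN : forall x y, K y x = - K x y.
Hypothesis Khom : similarity_homogeneous (- (2 * n%:R)) K.
Hypothesis K0 : forall y, K 0 y = 0.
Hypothesis Kint : (\int[L]_y (`|K (e1 n) y| * enorm (e1 n - y) `^ eta)%:E < +oo)%E.

Let Vfst : measurable_fun setT (fst : V * V -> V). Proof. exact: measurable_fst. Qed.
Let Vsnd : measurable_fun setT (snd : V * V -> V). Proof. exact: measurable_snd. Qed.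

Let menormB : measurable_fun setT (fun z : V * V => enorm (z.1 - z.2)).
Proof.
apply: (measurableT_comp (@measurable_enorm R n)).
by apply: measurable_funBrV.
Qed.

Let section1 (G : V -> V -> R) x : measurable_fun setT (fun z : V * V => G z.1 z.2) ->
  measurable_fun setT (G x).
Proof. by move=> mG; exact: (measurableT_comp mG (pair1_measurable x)). Qed.

Let W x y := `|K x y| * enorm (x - y) `^ eta.

Let mW : measurable_fun setT (fun z : V * V => W z.1 z.2).
Proof.
apply: measurable_funM; last exact: measurable_funPowR.
by apply: measurableT_comp.
Qed.

Let W0 x y : 0 <= W x y. Proof. by rewrite mulr_ge0 ?powR_ge0. Qed.

Let WC x y : W y x = W x y. Proof. by rewrite /W KN normrN enormBC. Qed.

Let Whom : similarity_homogeneous (- (2 * n%:R) + eta) W.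
Proof.
have [Ka Kv] := Khom; split=> [a x y a0|v x y]; rewrite /W.
  rewrite Ka// -scalerBr enormZ (gtr0_norm a0) normrM (ger0_norm (powR_ge0 _ _)).
  rewrite powRM ?enorm_ge0 ?ltW// powRD ?(gt_eqF a0) ?implybT//; ring.
rewrite Kv; congr (_ * _ `^ _).
have -> : reflection v x - reflection v y = reflection v (x - y).
  by rewrite reflectionD -[- y]scaleN1r reflectionZ scaleN1r.
exact: enorm_reflection.
Qed.

(** Up to a constant, |x|^(eta-n) is the integral of [W x y] over y, because [W] has degree eta -
    2n. The condition therefore makes W(x, y) g(x) integrable over pairs. *)
Definition weight g := [/\ measurable_fun setT g, forall x, 0 <= g x &
  (\int[L]_x (enorm x `^ (eta - n%:R) * g x)%:E < +oo)%E].

(** A Holder bound whose constant may blow up at a point, as it does for |x - e1|^(s-n) at e1. *)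
Definition holder_weight phi g := forall x y,
  `|phi x - phi y| <= enorm (x - y) `^ eta * (g x + g y).

Let W_weight1 g : weight g ->
  (\int[L \x L]_z (W z.1 z.2 * g z.1)%:E < +oo)%E.
Proof.
move=> [mg g0 goo].
have [H H0 HE] := ge0_integral_fin_numP (W0 (e1 n)) Kint.
have mF : measurable_fun setT (fun z : V * V => (W z.1 z.2 * g z.1)%:E).
  by apply/measurable_EFinP; apply: measurable_funM => //; exact: (measurableT_comp mg).
have mpow : measurable_fun setT (fun x : V => enorm x `^ (eta - n%:R) * g x).
  by apply: measurable_funM => //; apply: measurable_funPowR; exact: measurable_enorm.
rewrite (fubini_tonelli1 (fun z : V * V => (W z.1 z.2 * g z.1)%:E)); first last.
- by move=> z; rewrite lee_fin mulr_ge0.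
- exact: mF.
apply: (@le_lt_trans _ _ (\int[L]_x (H * (enorm x `^ (eta - n%:R) * g x))%:E)%E); last first.
  by apply: ge0_integralZ_fin => // x; rewrite mulr_ge0 ?powR_ge0.
apply: ge0_le_integral.
- exact: measurableT.
- by move=> x _; apply: integral_ge0 => y _; rewrite lee_fin mulr_ge0.
- apply: (measurable_fun_fubini_tonelli_F (fun z : V * V => (W z.1 z.2 * g z.1)%:E)) => //.
  by move=> z; rewrite lee_fin mulr_ge0.
- by apply/measurable_EFinP; apply: measurable_funM.
move=> x _; rewrite /fubini_F/=.
have [->|x0] := eqVneq x 0.
  rewrite integral0_eq; first by rewrite lee_fin !mulr_ge0 ?powR_ge0.
  by move=> y _; rewrite /W K0 normr0 !mul0r.
under eq_integral do rewrite mulrC EFinM.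
rewrite (ge0_integralZl_EFin _ measurableT); [|by move=> y _; rewrite lee_fin|
  by apply/measurable_EFinP; exact: section1|exact: g0].
rewrite (ge0_integral_homogeneous n0 Whom (fun z => section1 z mW) W0 x0).
rewrite HE (_ : - (2 * n%:R) + eta + n%:R = eta - n%:R); last by ring.
by rewrite -!EFinM lee_fin; rewrite le_eqVlt; apply/orP; left; apply/eqP; ring.
Qed.

Lemma kernel_weight_fin g : weight g ->
  (\int[L \x L]_z (W z.1 z.2 * (g z.1 + g z.2))%:E < +oo)%E.
Proof.
move=> wg; have [mg g0 _] := wg.
have mWg1 : measurable_fun setT (fun z : V * V => W z.1 z.2 * g z.1).
  by apply: measurable_funM => //; exact: (measurableT_comp mg).
have mWg2 : measurable_fun setT (fun z : V * V => W z.1 z.2 * g z.2).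
  by apply: measurable_funM => //; exact: (measurableT_comp mg).
under eq_integral do rewrite mulrDr.
apply: (ge0_integralD_fin mWg1 mWg2).
- by move=> z; rewrite mulr_ge0.
- by move=> z; rewrite mulr_ge0.
- exact: W_weight1.
have iF : (L \x L)%E.-integrable setT (EFin \o (fun z : V * V => W z.1 z.2 * g z.1)).
  apply: integrable_EFinP => //.
  rewrite (eq_integral (fun z : V * V => (W z.1 z.2 * g z.1)%:E)); first exact: W_weight1.
  by move=> z _; rewrite ger0_norm// mulr_ge0.
rewrite (_ : (\int[L \x L]_z _ = \int[L \x L]_z (W z.1 z.2 * g z.1)%:E)%E); first exact: W_weight1.
by rewrite -(integral2_swap iF); apply: eq_integral => z _; rewrite /= WC.
Qed.

Lemma kernel_integrable phi g : measurable_fun setT phi -> weight g ->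
  holder_weight phi g ->
  (L \x L)%E.-integrable setT (fun z => (K z.1 z.2 * (phi z.1 - phi z.2))%:E).
Proof.
move=> mphi wg hphi; have [mg g0 _] := wg.
apply: (@le_integrable _ _ _ _ _ _ _ (fun z : V * V => (W z.1 z.2 * (g z.1 + g z.2))%:E)).
- exact: measurableT.
- apply/measurable_EFinP; apply: measurable_funM => //.
  by apply: measurable_funB; exact: (measurableT_comp mphi).
- move=> z _; rewrite lee_fin normrM [leRHS]ger0_norm; last by rewrite mulr_ge0// addr_ge0.
  by rewrite /W -mulrA ler_wpM2l.
- apply: (@integrable_EFinP _ _ _ _ (fun z : V * V => W z.1 z.2 * (g z.1 + g z.2))).
    by apply: measurable_funM => //; apply: measurable_funD; exact: (measurableT_comp mg).
  rewrite (eq_integral (fun z : V * V => (W z.1 z.2 * (g z.1 + g z.2))%:E)).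
    exact: kernel_weight_fin.
  by move=> z _; rewrite ger0_norm// mulr_ge0// addr_ge0.
Qed.

(** * Truncation of the kernel near the diagonal *)

Section truncation.
Variables (eps : R) (eps0 : 0 < eps).

(** The cut-off distance is proportional to the norms, so that dilations preserve the region; asking
    it for both points keeps the region symmetric. *)
Definition truncated_kernel x y : R :=
  if (eps * enorm x < enorm (x - y)) && (eps * enorm y < enorm (x - y))
  then K x y else 0.
Local Notation Ke := truncated_kernel.

Lemma measurable_truncated_kernel :
  measurable_fun setT (fun z : V * V => Ke z.1 z.2).
Proof.
apply: measurable_fun_ifT => //.
apply: measurable_and; apply: measurable_fun_ltr => //; apply: measurable_funM => //.
  by apply: (measurableT_comp (@measurable_enorm R n)).
by apply: (measurableT_comp (@measurable_enorm R n)).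
Qed.
Let mKe := measurable_truncated_kernel.

Lemma truncated_kernel_anti x y : Ke y x = - Ke x y.
Proof.
by rewrite /Ke (enormBC y) KN andbC; case: ifP => _ //; rewrite oppr0.
Qed.

Lemma truncated_kernel_le x y : `|Ke x y| <= `|K x y|.
Proof. by rewrite /Ke; case: ifP => // _; rewrite normr0. Qed.

Lemma truncated_kernel_homogeneous : similarity_homogeneous (- (2 * n%:R)) Ke.
Proof.
have [Ka Kv] := Khom; split=> [a x y a0|v x y]; rewrite /Ke.
  rewrite -scalerBr !enormZ (gtr0_norm a0) !(mulrCA eps) !ltr_pM2l//.
  by rewrite Ka//; case: ifP => _ //; rewrite mulr0.
have -> : reflection v x - reflection v y = reflection v (x - y).
  by rewrite reflectionD -[- y]scaleN1r reflectionZ scaleN1r.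
by rewrite !enorm_reflection Kv.
Qed.

Let absKe_fin1 : (\int[L]_y (`|Ke (e1 n) y|)%:E < +oo)%E.
Proof.
(* On the support of the truncated kernel |e1 - y| > eps, so inserting |e1 - y|^eta costs at most
   the factor eps^(-eta). *)
apply: (@le_integral_fin _ _ _ L _ (fun y => (eps `^ (- eta)) * W (e1 n) y)).
- by apply: (measurableT_comp (@normr_measurable R setT)); exact: section1.
- by apply: measurable_funM; [exact: measurable_cst|exact: (section1 _ mW)].
- move=> y; rewrite normr_ge0/= /Ke enorm_e1// mulr1.
  case: ifP => [/andP[e1y _]|_]; last by rewrite normr0 mulr_ge0 ?powR_ge0.
  rewrite /W mulrCA ler_peMr// powRN mulrC ler_pdivlMr ?powR_gt0// mul1r.
  have /andP[eta0 _] := eta01.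
  by apply: ge0_ler_powR; rewrite ?nnegrE ?enorm_ge0// ltW.
apply: ge0_integralZ_fin.
- exact: (section1 _ mW).
- exact: W0.
- exact: powR_ge0.
- exact: Kint.
Qed.

Let absKe_hom : similarity_homogeneous (- (2 * n%:R)) (fun x y => `|Ke x y|).
Proof.
have [Ka Kv] := truncated_kernel_homogeneous.
split=> [a x y a0|v x y]; last by rewrite Kv.
by rewrite Ka// normrM (ger0_norm (powR_ge0 _ _)).
Qed.

Let mabsKe x : measurable_fun setT (fun y => `|Ke x y|).
Proof. by apply: (measurableT_comp (@normr_measurable R setT)); exact: section1. Qed.

Let Ke0 y : Ke 0 y = 0.
Proof. by rewrite /Ke K0 if_same. Qed.

Let expE : - (2 * n%:R) + n%:R = - n%:R :> R. Proof. by ring. Qed.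

Let iKe x : L.-integrable setT (EFin \o Ke x).
Proof.
apply: integrable_EFinP; first exact: section1.
have [->|x0] := eqVneq x 0.
  by rewrite integral0_eq ?ltry// => y _; rewrite Ke0 normr0.
rewrite (ge0_integral_homogeneous n0 absKe_hom mabsKe (fun=> fun=> normr_ge0 _) x0).
have [r r0 ->] := @ge0_integral_fin_numP _ _ _ L (fun y => `|Ke (e1 n) y|) (fun=> normr_ge0 _) absKe_fin1.
exact: ltry.
Qed.

(** Since |x|^(-n) is integrable neither at 0 nor at infinity, this asks for vanishing at 0 and
    decay at infinity in an averaged sense. The power arises as the integral of |K_eps(x, .)|, up to
    a constant. *)
Definition vanishing_at0 psi :=
  measurable_fun setT psi /\ (\int[L]_x (`|psi x| * enorm x `^ (- n%:R))%:E < +oo)%E.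

Let mpow psi : measurable_fun setT psi ->
  measurable_fun setT (fun x => psi x * enorm x `^ (- n%:R)).
Proof.
by move=> mpsi; apply: measurable_funM => //; apply: measurable_funPowR; exact: measurable_enorm.
Qed.

Let mnorm psi : measurable_fun setT psi -> measurable_fun setT (fun x => `|psi x|).
Proof. by move=> ?; apply: (measurableT_comp (@normr_measurable R setT)). Qed.

Lemma truncated_kernel_integrable psi : vanishing_at0 psi ->
  (L \x L)%E.-integrable setT (EFin \o (fun z : V * V => Ke z.1 z.2 * psi z.1)).
Proof.
move=> [mpsi psioo].
have [k k0 kE] := @ge0_integral_fin_numP _ _ _ L (fun y => `|Ke (e1 n) y|) (fun=> normr_ge0 _) absKe_fin1.
have mF : measurable_fun setT (fun z : V * V => Ke z.1 z.2 * psi z.1).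
  by apply: measurable_funM => //; exact: (measurableT_comp mpsi).
apply: integrable_EFinP => //.
have mF' : measurable_fun setT (fun z : V * V => (`|Ke z.1 z.2 * psi z.1|)%:E).
  by apply/measurable_EFinP; apply: (measurableT_comp (@normr_measurable R setT)).
rewrite (fubini_tonelli1 (fun z : V * V => (`|Ke z.1 z.2 * psi z.1|)%:E)); first last.
- by move=> z; rewrite lee_fin.
- exact: mF'.
apply: (@le_lt_trans _ _ (\int[L]_x (k * (`|psi x| * enorm x `^ (- n%:R)))%:E)%E); last first.
  apply: ge0_integralZ_fin => //; first by apply: mpow; exact: mnorm.
  by move=> x; rewrite mulr_ge0 ?powR_ge0.
apply: ge0_le_integral.
- exact: measurableT.
- by move=> x _; apply: integral_ge0 => y _; rewrite lee_fin.
- apply: (measurable_fun_fubini_tonelli_F (fun z : V * V => (`|Ke z.1 z.2 * psi z.1|)%:E)).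
    exact: mF'.
  by move=> z; rewrite lee_fin normr_ge0.
- by apply/measurable_EFinP; apply: measurable_funM => //; apply: mpow; exact: mnorm.
move=> x _; rewrite /fubini_F/=.
have [->|x0] := eqVneq x 0.
  rewrite integral0_eq; first by rewrite lee_fin !mulr_ge0 ?powR_ge0.
  by move=> y _; rewrite Ke0 mul0r normr0.
under eq_integral do rewrite normrM mulrC EFinM.
rewrite (ge0_integralZl_EFin _ measurableT); [|by move=> y _; rewrite lee_fin|
  by apply/measurable_EFinP|exact: normr_ge0].
rewrite (ge0_integral_homogeneous n0 absKe_hom mabsKe (fun=> fun=> normr_ge0 _) x0).
rewrite kE expE.
by rewrite -!EFinM lee_fin; rewrite le_eqVlt; apply/orP; left; apply/eqP; ring.
Qed.

Let ke := fine (\int[L]_y (Ke (e1 n) y)%:E).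

Let ipsi psi : vanishing_at0 psi ->
  L.-integrable setT (EFin \o (fun x => psi x * enorm x `^ (- n%:R))).
Proof.
move=> [mpsi psioo]; apply: integrable_EFinP; first exact: mpow.
by under eq_integral do rewrite normrM (ger0_norm (powR_ge0 _ _)).
Qed.

Let keE : (\int[L]_y (Ke (e1 n) y)%:E = ke%:E)%E.
Proof. by apply/esym; apply: fineK; exact: (integrable_fin_num measurableT (iKe (e1 n))). Qed.

Lemma truncated_kernel_integral psi : vanishing_at0 psi ->
  (\int[L \x L]_z (Ke z.1 z.2 * psi z.1)%:E =
   ke%:E * \int[L]_x (psi x * enorm x `^ (- n%:R))%:E)%E.
Proof.
move=> vpsi; have [mpsi psioo] := vpsi.
have iF := truncated_kernel_integrable vpsi.
rewrite -(integral12_prod_meas1 iF).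
rewrite -(integralZl measurableT (ipsi vpsi)).
apply: eq_integral => x _; rewrite /fubini_F/=.
(* Both sides vanish at x = 0: the kernel by convention, and the power because [powR] sends 0 to 0
   for the nonzero exponent -n. *)
have [->|x0] := eqVneq x 0.
  rewrite integral0_eq; last by move=> y _; rewrite Ke0 mul0r.
  by rewrite enorm0 powR0 ?mulr0 ?mule0// oppr_eq0 pnatr_eq0 -lt0n.
transitivity (\int[L]_y ((psi x)%:E * (Ke x y)%:E))%E.
  by apply: eq_integral => y _; rewrite -EFinM mulrC.
rewrite (integralZl measurableT (iKe x)).
rewrite (integral_homogeneous n0 truncated_kernel_homogeneous iKe x0) keE expE.
by rewrite -!EFinM; congr EFin; ring.
Qed.

(** After truncation the parts in psi(x) and psi(y) are separately integrable; exchanging the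
    variables turns the second into minus the first, whence the factor 2. *)
Lemma truncated_form_integral psi : vanishing_at0 psi ->
  (\int[L \x L]_z (Ke z.1 z.2 * (psi z.1 - psi z.2))%:E =
   (2 * ke)%:E * \int[L]_x (psi x * enorm x `^ (- n%:R))%:E)%E.
Proof.
move=> vpsi; have iF := truncated_kernel_integrable vpsi.
have [c cE] := integrable_fin_numP (ipsi vpsi).
have iF' : (L \x L)%E.-integrable setT (EFin \o (fun z : V * V => Ke z.1 z.2 * psi z.2)).
  have mF' : measurable_fun setT (fun z : V * V => Ke z.1 z.2 * psi z.2).
    by case: vpsi => mpsi _; apply: measurable_funM => //; exact: (measurableT_comp mpsi).
  have /integrableP[mF Foo] := iF.
  apply: integrable_EFinP => //.
  have iabs : (L \x L)%E.-integrable setT (EFin \o (fun z : V * V => `|Ke z.1 z.2 * psi z.1|)).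
    exact: (integrable_abse iF).
  rewrite (_ : (\int[L \x L]_z _ = \int[L \x L]_z (`|Ke z.1 z.2 * psi z.1|)%:E)%E); first exact: Foo.
  rewrite -(integral2_swap iabs); apply: eq_integral => z _.
  by rewrite /= (truncated_kernel_anti z.1) mulNr normrN.
have E2 : (\int[L \x L]_z (Ke z.1 z.2 * psi z.2)%:E = - (ke * c)%:E)%E.
  rewrite -(integral2_swap iF')/=.
  rewrite (eq_integral (fun z : V * V => - (Ke z.1 z.2 * psi z.1)%:E)%E); last first.
    by move=> z _; rewrite (truncated_kernel_anti z.1) mulNr EFinN.
  rewrite integralN; last first.
    by apply: fin_num_adde_defr; exact: (integrable_pos_fin_num measurableT iF).
  by rewrite (truncated_kernel_integral vpsi) cE -EFinM.
transitivity (\int[L \x L]_z ((Ke z.1 z.2 * psi z.1)%:E - (Ke z.1 z.2 * psi z.2)%:E))%E.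
  by apply: eq_integral => z _; rewrite -EFinB mulrBr.
rewrite (integralB measurableT iF iF') E2 (truncated_kernel_integral vpsi) cE.
by rewrite -!EFinM oppeK -EFinD; congr EFin; ring.
Qed.

End truncation.

(** * The tent cutoff and compactly supported Lipschitz functions *)

Lemma cube_enorm (a b : R) x : 0 < a -> cube a b x -> a <= enorm x <= n%:R * b.
Proof.
move=> a0 hx; have hi i : a <= x ord0 i <= b by have /= := hx i; rewrite in_itv.
apply/andP; split.
  have [m nm] : exists m, n = m.+1 by exists n.-1; rewrite prednK.
  have i : 'I_n by rewrite nm; exact: ord0.
  have /andP[ai _] := hi i; apply: le_trans ai _.
  exact: le_trans (ler_norm _) (le_coord_enorm _ _).
apply: le_trans (enorm_le_sum x) _.
apply: (@le_trans _ _ (\sum_(i < n) b)).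
  apply: ler_sum => i _; have /andP[ai ib] := hi i.
  by rewrite ger0_norm// (le_trans (ltW a0)).
by rewrite sumr_const card_ord -[X in X <= _]mulr_natl.
Qed.

(** This is the cutoff chi of the overview. It is Lipschitz, equal to 1 at 0 and radially
    decreasing; the monotonicity gives the sign both of the dyadic difference and of the final
    constant. *)
Definition tent x : R := Num.max 0 (1 - enorm x).

Lemma measurable_tent : measurable_fun setT tent.
Proof.
apply: measurable_maxr; first exact: measurable_cst.
by apply: measurable_funB; [exact: measurable_cst|exact: measurable_enorm].
Qed.

Lemma tent0 : tent 0 = 1.
Proof. by rewrite /tent enorm0 subr0; apply/max_idPr; exact: ler01. Qed.

Lemma tent_out x : 1 <= enorm x -> tent x = 0.
Proof. by move=> x1; apply/max_idPl; rewrite subr_le0. Qed.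

Lemma tent_le x y : enorm x <= enorm y -> tent y <= tent x.
Proof. by move=> xy; rewrite /tent ge_max !le_max lexx/= lerB// orbT. Qed.

Lemma tent_lipschitz x y : `|tent x - tent y| <= enorm (x - y).
Proof.
wlog xy : x y / enorm x <= enorm y.
  move=> h; have [/h//|/ltW/h] := leP (enorm x) (enorm y).
  by rewrite distrC enormBC.
rewrite ger0_norm ?subr_ge0 ?tent_le//.
apply: (@le_trans _ _ (enorm y - enorm x)).
  rewrite /tent; case: (leP 0 (1 - enorm x)); case: (leP 0 (1 - enorm y)); lra.
by apply: le_trans (ler_norm _) _; rewrite enormBC ler_dist_enorm.
Qed.

Let nR : n%:R != 0 :> R. Proof. by rewrite pnatr_eq0 -lt0n. Qed.
Let n1 : 1 <= n%:R :> R. Proof. by rewrite ler1n. Qed.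

Lemma lipschitz_weight phi (C M : R) : 0 <= C -> 0 < M ->
  (forall x y, `|phi x - phi y| <= C * enorm (x - y)) ->
  (forall x, M < enorm x -> phi x = 0) ->
  exists2 g, weight g & holder_weight phi g.
Proof.
move=> C0 M0 philip phiM; have /andP[eta0 eta1] := eta01.
(* A bound for |phi|: a point of norm at most M is compared with (M + 1) e1, where phi vanishes, at
   distance at most 2M + 1. *)
pose B := C * (2 * M + 1).
have B0 : 0 <= B by rewrite mulr_ge0// addr_ge0// mulr_ge0// ltW.
have phiB x : `|phi x| <= B.
  have [xM|/phiM->] := leP (enorm x) M; last by rewrite normr0.
  rewrite -[phi x]subr0 -(phiM ((M + 1) *: e1 n)).
    apply: le_trans (philip _ _) _; rewrite ler_wpM2l// -[- _]scaleN1r scalerA.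
    apply: le_trans (ler_enormD _ _) _.
    by rewrite enormZ enorm_e1// mulN1r normrN ger0_norm; lra.
  by rewrite enormZ enorm_e1// ger0_norm; lra.
(* The term C serves |x - y| <= 1, where |x - y| <= |x - y|^eta; the term 2B serves |x - y| > 1,
   where |x - y|^eta >= 1. *)
pose A := C + 2 * B.
have A0 : 0 <= A by rewrite addr_ge0// mulr_ge0.
pose I : set (measurableTypeR R) := `]-oo, M]%classic.
have mI : measurable_fun setT (fun x => \1_I (enorm x) : R).
  apply: (measurableT_comp (f := \1_I : R -> R)); last exact: measurable_enorm.
  by apply: measurable_indic; exact: measurable_itv.
have mg : measurable_fun setT (fun x => A * \1_I (enorm x)).
  by apply: measurable_funM => //; exact: measurable_cst.
have g0 x : 0 <= A * \1_I (enorm x) by rewrite mulr_ge0// indicE.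
exists (fun x => A * \1_I (enorm x)).
  split => //.
  apply: (@le_integral_fin _ _ _ L _ (fun x => A * truncated_power eta `]0, M] x)).
  - apply: measurable_funM => //.
    by apply: measurable_funPowR; exact: measurable_enorm.
  - apply: measurable_funM; first exact: measurable_cst.
    by apply: measurable_truncated_power; exact: measurable_itv.
  - move=> x; rewrite mulr_ge0 ?powR_ge0//= mulrCA ler_wpM2l// /truncated_power.
    have [->|x0] := eqVneq x 0.
      rewrite enorm0 powR0 ?mul0r// subr_eq0 lt_eqF//.
      exact: lt_le_trans n1.
    rewrite ler_wpM2l ?powR_ge0// !indicE.
    case: (boolP (enorm x \in I)) => // xI; rewrite mem_set//.
    by move: xI; rewrite inE /I/= !in_itv/= enorm_gt0 x0 => ->.
  - apply: ge0_integralZ_fin => //; last exact: integral_near_fin.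
      by apply: measurable_truncated_power; exact: measurable_itv.
    exact: truncated_power_ge0.
move=> x y; rewrite -mulrDr.
have IE z : \1_I (enorm z) = ((enorm z <= M)%R)%:R :> R.
  by rewrite indicE; congr (_%:R); congr nat_of_bool; apply/idP/idP; rewrite inE /I/= in_itv.
rewrite !IE; have [xyM|] := boolP ((enorm x <= M) || (enorm y <= M)); last first.
  rewrite negb_or -!ltNge => /andP[xM yM].
  by rewrite !phiM// subrr normr0 !mulr_ge0 ?powR_ge0.
apply: (@le_trans _ _ (enorm (x - y) `^ eta * A)); last first.
  rewrite ler_wpM2l ?powR_ge0// ler_peMr//.
  by case/orP: xyM => ->; rewrite ?lerDl ?lerDr.
rewrite mulrC /A mulrDl; have [xy|xy] := leP (enorm (x - y)) 1.
  apply: (@le_trans _ _ (C * enorm (x - y) `^ eta)).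
    apply: le_trans (philip _ _) _; rewrite ler_wpM2l//.
    have [->|xy0] := eqVneq (x - y) 0; first by rewrite enorm0 powR_ge0.
    by apply: ger1_powR; rewrite ?enorm_gt0 ?xy0 ?xy// ltW.
  by rewrite lerDl mulr_ge0 ?powR_ge0// mulr_ge0.
apply: (@le_trans _ _ (2 * B * enorm (x - y) `^ eta)); last first.
  by rewrite lerDr mulr_ge0 ?powR_ge0.
apply: (@le_trans _ _ (2 * B)).
  by apply: le_trans (ler_normB _ _) _; rewrite mulr_natl mulr2n lerD.
have := ler_powR (ltW xy) (ltW eta0); rewrite powRr0 => pow1.
by rewrite ler_peMr// mulr_ge0.
Qed.

(** Linear vanishing at the origin improves |x|^(-n) to |x|^(1-n), which is locally integrable. *)
Lemma lipschitz_vanishing phi (C M : R) : 0 <= C -> 0 < M ->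
  measurable_fun setT phi ->
  (forall x, `|phi x| <= C * enorm x) ->
  (forall x, M < enorm x -> phi x = 0) -> vanishing_at0 phi.
Proof.
move=> C0 M0 mphi philip phiM; split; first exact: mphi.
apply: (@le_integral_fin _ _ _ L _ (fun x => C * truncated_power 1 `]0, M] x)).
- apply: measurable_funM; first by apply: (measurableT_comp (@normr_measurable R setT)).
  by apply: measurable_funPowR; exact: measurable_enorm.
- apply: measurable_funM; first exact: measurable_cst.
  by apply: measurable_truncated_power; exact: measurable_itv.
- move=> x; rewrite mulr_ge0 ?powR_ge0//= /truncated_power.
  have [xM|/phiM->] := leP (enorm x) M; last first.
    by rewrite normr0 mul0r !mulr_ge0 ?powR_ge0// indicE.
  have [->|x0] := eqVneq x 0.
    by rewrite enorm0 (powR0 (x := - _)) ?oppr_eq0// mulr0 !mulr_ge0 ?powR_ge0// indicE.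
  have nx : 0 < enorm x by rewrite enorm_gt0.
  rewrite indicE mem_set/= ?in_itv/= ?nx// mulr1.
  rewrite powRD ?(gt_eqF nx) ?implybT// powRr1 ?enorm_ge0// mulrA.
  by rewrite ler_wpM2r ?powR_ge0.
- apply: ge0_integralZ_fin => //; last exact: integral_near_fin.
    by apply: measurable_truncated_power; exact: measurable_itv.
  exact: truncated_power_ge0.
Qed.

Lemma tent_weight : exists2 g, weight g & holder_weight tent g.
Proof.
apply: (@lipschitz_weight tent 1 1) => // [x y|x x1].
  by rewrite mul1r; exact: tent_lipschitz.
by apply: tent_out; exact: ltW.
Qed.

(** * Vanishing of the truncated form and passage to the limit *)

Lemma truncated_form_integrable eps psi g : measurable_fun setT psi -> weight g ->
  holder_weight psi g -> (L \x L)%E.-integrable setT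
    (EFin \o (fun z => truncated_kernel eps z.1 z.2 * (psi z.1 - psi z.2))).
Proof.
move=> mpsi wg hpsi; have := kernel_integrable mpsi wg hpsi.
apply: le_integrable.
- exact: measurableT.
- apply/measurable_EFinP; apply: measurable_funM.
    exact: measurable_truncated_kernel.
  by apply: measurable_funB; exact: (measurableT_comp mpsi).
- move=> z _; rewrite /= lee_fin !normrM ler_wpM2r//.
  exact: truncated_kernel_le.
Qed.

Lemma truncated_form_zero eps psi : 0 < eps -> vanishing_at0 psi ->
  (\int[L \x L]_z (truncated_kernel eps z.1 z.2 * (psi z.1 - psi z.2))%:E = 0)%E.
Proof.
move=> eps0 vpsi; rewrite truncated_form_integral//.
set k := fine _; suff -> : k = 0 by rewrite mulr0 mul0e.
pose Ke := truncated_kernel eps.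
(* Here [chi] is the dyadic difference of the cutoff, called psi in the overview: nonnegative, at
   most |x|, and zero outside the unit ball. *)
pose chi x := tent x - tent (2 *: x).
have mtent2 : measurable_fun setT (fun x => tent (2 *: x)).
  apply: (measurableT_comp measurable_tent).
  by apply: measurable_funZrV; [exact: measurable_cst|exact: measurable_id].
have mchi : measurable_fun setT chi.
  by apply: measurable_funB => //; exact: measurable_tent.
have E2 x : enorm (2 *: x) = 2 * enorm x by rewrite enormZ ger0_norm.
have chi0 x : 0 <= chi x.
  by rewrite subr_ge0 tent_le// E2 ler_peMl ?enorm_ge0// ler1n.
have vchi : vanishing_at0 chi.
  apply: (@lipschitz_vanishing chi 1 1) => // x.
    rewrite mul1r; apply: le_trans (tent_lipschitz _ _) _.
    by rewrite scaler_nat mulr2n opprD addrA subrr sub0r enormN.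
  move=> x1; rewrite /chi !tent_out ?subrr//; last exact: ltW.
  by rewrite E2; have := enorm_ge0 x; lra.
have [g wg hg] := tent_weight.
pose F (z : V * V) := Ke z.1 z.2 * (tent z.1 - tent z.2).
have iF : (L \x L)%E.-integrable setT (EFin \o F).
  exact: (truncated_form_integrable eps measurable_tent wg hg).
have [c cE] := integrable_fin_numP iF.
have [Kea _] := truncated_kernel_homogeneous eps.
pose F2 (z : V * V) := Ke z.1 z.2 * (tent (2 *: z.1) - tent (2 *: z.2)).
have F2E z : F2 z = 2 `^ (2 * n%:R) * F (2 *: z.1, 2 *: z.2).
  by rewrite /F2 /F /Ke/= Kea// powRN !mulrA mulfV ?mul1r// gt_eqF// powR_gt0.
have iF2 : (L \x L)%E.-integrable setT (EFin \o F2).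
  have [||x y|x x1|g2 wg2 hg2] := @lipschitz_weight (fun x => tent (2 *: x)) 2 1 => //.
  - by apply: le_trans (tent_lipschitz _ _) _; rewrite -scalerBr E2.
  - by apply: tent_out; rewrite E2; have := enorm_ge0 x; lra.
  exact: (truncated_form_integrable eps mtent2 wg2 hg2).
have [d dE] := integrable_fin_numP iF2.
have p0 : 0 < 2 `^ (2 * n%:R) :> R by exact: powR_gt0.
(* The degree -2n of the kernel cancels the Jacobian of the dilation by 2 on pairs. *)
have dc : d = c.
  have := integral2_scale (ltr0n R 2) iF; rewrite cE.
  have -> : (\int[L \x L]_z (F (2 *: z.1, 2 *: z.2))%:E =
      ((2 `^ (2 * n%:R))^-1)%:E * \int[L \x L]_z (F2 z)%:E)%E.
    rewrite -(integralZl measurableT iF2); apply: eq_integral => z _.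
    by rewrite -EFinM F2E mulrA mulVf ?mul1r// gt_eqF.
  by rewrite dE powRN -!EFinM => -[] /mulfI; apply; rewrite invr_eq0 gt_eqF.
have F2c : (\int[L \x L]_z (F2 z)%:E = c%:E)%E by rewrite dE dc.
have T0 : (\int[L \x L]_z (Ke z.1 z.2 * (chi z.1 - chi z.2))%:E = 0)%E.
  transitivity (\int[L \x L]_z ((F z)%:E - (F2 z)%:E))%E.
    by apply: eq_integral => z _; rewrite -EFinB; congr EFin; rewrite /F /F2 /chi; ring.
  by rewrite (integralB measurableT iF iF2) cE F2c subee.
have vchiE := truncated_form_integral eps0 vchi.
have pchi0 x : 0 <= chi x * enorm x `^ (- n%:R) by rewrite mulr_ge0 ?powR_ge0.
have mpchi : measurable_fun setT (fun x => chi x * enorm x `^ (- n%:R)).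
  by apply: measurable_funM => //; apply: measurable_funPowR; exact: measurable_enorm.
have pchioo : (\int[L]_x (chi x * enorm x `^ (- n%:R))%:E < +oo)%E.
  rewrite (eq_integral (fun x => (`|chi x| * enorm x `^ (- n%:R))%:E)); first exact: vchi.2.
  by move=> x _; rewrite ger0_norm.
have [q _ qE] := ge0_integral_fin_numP pchi0 pchioo.
have q0 : 0 < q.
  (* On the cube with coordinates in [a, b] one has a <= |x| <= n b = 1/2. There both tents are
     affine in |x|, so chi(x) = |x|, and |x|^(-n) >= 1, so the integrand is at least a. *)
  pose b : R := (2 * n%:R)^-1; pose a := b / 2.
  have b0 : 0 < b by rewrite invr_gt0 mulr_gt0// ltr0n.
  have a0 : 0 < a by rewrite divr_gt0.
  have ab : a < b by rewrite /a; lra.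
  rewrite -lte_fin -qE.
  apply: (@lt_le_trans _ _ (\int[L]_x (a * \1_(cube a b) x)%:E)%E).
    under eq_integral do rewrite EFinM.
    rewrite (ge0_integralZl_EFin _ measurableT); [|by move=> x _; rewrite lee_fin indicE|
      by apply/measurable_EFinP; apply: measurable_indic; exact: measurable_cube|exact: ltW].
    rewrite integral_indic ?setIT; [|exact: measurableT|exact: measurable_cube].
    rewrite -[X in (_ * X)%E]/(lebesgue_rV R n (cube a b)) lebesgue_rV_cube; last exact: ltW.
    by rewrite -EFinM lte_fin mulr_gt0// exprn_gt0// subr_gt0.
  apply: ge0_le_integral.
  - exact: measurableT.
  - by move=> x _; rewrite lee_fin mulr_ge0 ?indicE// ltW.
  - apply/measurable_EFinP; apply: measurable_funM; first exact: measurable_cst.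
    by apply: measurable_indic; exact: measurable_cube.
  - exact/measurable_EFinP.
  move=> x _; rewrite lee_fin indicE.
  have [|_] := boolP (x \in cube a b); last by rewrite mulr0.
  rewrite inE mulr1 => /(cube_enorm a0)/andP[ax xb].
  have xh : enorm x <= 2^-1.
    by apply: le_trans xb _; rewrite /b invfM mulrCA mulfV// mulr1.
  have x0 : 0 < enorm x by exact: lt_le_trans ax.
  have -> : chi x = enorm x.
    rewrite /chi /tent E2 (max_idPr _); last by lra.
    by rewrite (max_idPr _); lra.
  apply: (le_trans ax); rewrite ler_peMr ?enorm_ge0//.
  have xr1 : 0 < enorm x <= 1 by rewrite x0/=; lra.
  have nn : - n%:R <= 0 :> R by rewrite oppr_le0.
  by have := ger_powR xr1 nn; rewrite powRr0.
move: vchiE; rewrite T0 qE -EFinM => -[] /esym/eqP.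
by rewrite !mulf_eq0 (gt_eqF q0) orbF pnatr_eq0/= => /eqP.
Qed.

Let Kxx x : K x x = 0.
Proof. by have := KN x x; lra. Qed.

(** Dominated convergence along eps = 1/(k+1): off the diagonal the truncation is eventually
    inactive, on it both sides are 0, and the integrable untruncated form dominates. *)
Lemma kernel_form_zero psi g : measurable_fun setT psi -> weight g ->
  holder_weight psi g -> vanishing_at0 psi ->
  (\int[L \x L]_z (K z.1 z.2 * (psi z.1 - psi z.2))%:E = 0)%E.
Proof.
move=> mpsi wg hpsi vpsi.
have iK := kernel_integrable mpsi wg hpsi.
have e0 k : 0 < k.+1%:R^-1 :> R by rewrite invr_gt0.
pose f_ (k : nat) (z : V * V) := (truncated_kernel k.+1%:R^-1 z.1 z.2 * (psi z.1 - psi z.2))%:E.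
pose f (z : V * V) := (K z.1 z.2 * (psi z.1 - psi z.2))%:E.
have mB : measurable_fun setT (fun z : V * V => psi z.1 - psi z.2).
  by apply: measurable_funB; exact: (measurableT_comp mpsi).
have mf_ k : measurable_fun setT (f_ k).
  by apply/measurable_EFinP; apply: measurable_funM => //; exact: measurable_truncated_kernel.
have mf : measurable_fun setT f.
  by apply/measurable_EFinP; apply: measurable_funM.
have f_f : {ae (L \x L)%E, forall z, setT z -> f_ ^~ z @ \oo --> f z}.
  apply: aeW => -[x y] _; rewrite /f_ /f/=.
  have [->|xy] := eqVneq x y.
    by rewrite Kxx; apply: cvg_near_cst; apply: nearW => k; rewrite /truncated_kernel Kxx if_same.
  have d0 : 0 < enorm (x - y) by rewrite enorm_gt0 subr_eq0.
  (* Once eps m < |x - y| both truncation conditions hold; the summand 1 keeps m positive. *)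
  pose m := 1 + enorm x + enorm y.
  have m0 : 0 < m by have := enorm_ge0 x; have := enorm_ge0 y; rewrite /m; lra.
  have dm0 : 0 < enorm (x - y) / m by rewrite divr_gt0.
  apply: cvg_near_cst; near=> k; congr (_ * _)%:E; rewrite /truncated_kernel.
  have km : k.+1%:R^-1 * m < enorm (x - y).
    rewrite -ltr_pdivlMr//; near: k.
    exact: (near_infty_natSinv_lt (PosNum dm0)).
  rewrite ifT//; apply/andP; split; apply: le_lt_trans km; rewrite ler_wpM2l//.
    by rewrite /m; have := enorm_ge0 y; lra.
  by rewrite /m; have := enorm_ge0 x; lra.
have f_g : {ae (L \x L)%E, forall z k, setT z -> (`|f_ k z| <= `|f z|)%E}.
  apply: aeW => z k _; rewrite lee_fin !normrM ler_wpM2r//.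
  exact: truncated_kernel_le.
have ig : (L \x L)%E.-integrable setT (abse \o f) by exact: integrable_abse.
have [_ _ /= cvg] := dominated_convergence measurableT mf_ mf f_f ig f_g.
apply: (cvg_unique _ cvg) => //.
rewrite (_ : (fun _ => _) = cst 0%E); first exact: cvg_cst.
by apply/funext => k; exact: truncated_form_zero.
Unshelve. all: by end_near. Qed.

Lemma weightD g1 g2 : weight g1 -> weight g2 -> weight (fun x => g1 x + g2 x).
Proof.
move=> [m1 p1 i1] [m2 p2 i2]; split.
- exact: measurable_funD.
- by move=> x; rewrite addr_ge0.
have mp : measurable_fun setT (fun x : V => enorm x `^ (eta - n%:R)).
  by apply: measurable_funPowR; exact: measurable_enorm.
rewrite (eq_integral (fun x => (enorm x `^ (eta - n%:R) * g1 x + enorm x `^ (eta - n%:R) * g2 x)%:E)); last first.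
  by move=> x _; rewrite mulrDr.
apply: ge0_integralD_fin => //; try exact: measurable_funM.
- by move=> x; rewrite mulr_ge0 ?powR_ge0.
- by move=> x; rewrite mulr_ge0 ?powR_ge0.
Qed.

Lemma weightZ (c : R) g : 0 <= c -> weight g -> weight (fun x => c * g x).
Proof.
move=> c0 [mg g0 goo]; split.
- by apply: measurable_funM => //; exact: measurable_cst.
- by move=> x; rewrite mulr_ge0.
rewrite (eq_integral (fun x => (c * (enorm x `^ (eta - n%:R) * g x))%:E)); last first.
  by move=> x _; rewrite mulrCA.
apply: ge0_integralZ_fin => //.
- apply: measurable_funM => //.
  by apply: measurable_funPowR; exact: measurable_enorm.
- by move=> x; rewrite mulr_ge0 ?powR_ge0.
Qed.

Lemma kernel_form_dirac phi g : measurable_fun setT phi -> weight g ->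
  holder_weight phi g -> vanishing_at0 (fun x => phi x - phi 0 * tent x) ->
  (\int[L \x L]_z (K z.1 z.2 * (phi z.1 - phi z.2))%:E =
   (phi 0)%:E * \int[L \x L]_z (K z.1 z.2 * (tent z.1 - tent z.2))%:E)%E.
Proof.
move=> mphi wg hphi vpsi; have [h wh hh] := tent_weight.
have iphi := kernel_integrable mphi wg hphi.
have itent := kernel_integrable measurable_tent wh hh.
set psi := fun x => _ in vpsi.
have wpsi : weight (fun x => g x + `|phi 0| * h x).
  by apply: weightD => //; apply: weightZ.
have hpsi : holder_weight psi (fun x => g x + `|phi 0| * h x).
  move=> x y; rewrite /psi.
  have -> : phi x - phi 0 * tent x - (phi y - phi 0 * tent y) =
      (phi x - phi y) - phi 0 * (tent x - tent y) by ring.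
  apply: le_trans (ler_normB _ _) _; rewrite addrACA [leRHS]mulrDr lerD// normrM.
  by rewrite -mulrDr mulrCA ler_wpM2l.
have := kernel_form_zero vpsi.1 wpsi hpsi vpsi.
rewrite (eq_integral (fun z : V * V => ((K z.1 z.2 * (phi z.1 - phi z.2))%:E -
    (phi 0)%:E * (K z.1 z.2 * (tent z.1 - tent z.2))%:E)%E)); last first.
  by move=> z _; rewrite -EFinM -EFinB; congr EFin; rewrite /psi; ring.
have iZ := integrableZl measurableT (phi 0) itent.
rewrite (integralB measurableT iphi iZ) (integralZl measurableT itent).
have [c ->] := integrable_fin_numP iphi.
have [e ->] := integrable_fin_numP itent.
by rewrite -EFinM -EFinB => -[] /eqP; rewrite subr_eq0 => /eqP ->.
Qed.
End antisymmetric_kernel.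

(** * The kernel of the fundamental solution *)

Section radial_profile.
Context {R : realType}.
Implicit Types a b t delta e : R.

(** The free exponent interpolates between the Lipschitz bound (delta = 1) and growth slower than
    any given power. For t > 1, ln(1 + t) <= 1 + ln t <= (1 + delta ln t)/delta, and 1 + delta ln t
    <= t^delta by convexity of the exponential. *)
Lemma ln1D_le_powR t delta : 0 <= t -> 0 < delta <= 1 ->
  ln (1 + t) <= delta^-1 * t `^ delta.
Proof.
move=> t0 /andP[d0 d1].
have dV1 : 1 <= delta^-1 by rewrite invf_ge1.
have [->|tn0] := eqVneq t 0; first by rewrite addr0 ln1 mulr_ge0 ?powR_ge0// invr_ge0 ltW.
have tp : 0 < t by rewrite lt_def tn0.
have [t1|t1] := leP t 1.
  apply: (@le_trans _ _ t); first by apply: le_ln1Dx; lra.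
  apply: (@le_trans _ _ (t `^ delta)); first by apply: ger1_powR; rewrite ?tp.
  by rewrite ler_peMl ?powR_ge0.
apply: (@le_trans _ _ (1 + ln t)).
  apply: (@le_trans _ _ (ln (2 * t))); first by rewrite ler_ln ?posrE; lra.
  rewrite lnM ?posrE// lerD2r (_ : 2 = 1 + 1 :> R)//.
  by apply: le_ln1Dx; lra.
have pE : 1 + delta * ln t <= t `^ delta.
  have pp : 0 < t `^ delta by exact: powR_gt0.
  by rewrite -[leRHS]lnK ?posrE// ln_powR expR_ge1Dx.
rewrite mulrC ler_pdivlMr// mulrDl mul1r mulrC; apply: le_trans pE.
by rewrite lerD2r.
Qed.

Lemma ln_diff_le_powR a b delta : 0 < a -> a <= b -> 0 < delta <= 1 ->
  ln b - ln a <= delta^-1 * (a `^ (- delta) * (b - a) `^ delta).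
Proof.
move=> a0 ab d01; have b0 : 0 < b by exact: lt_le_trans ab.
have t0 : 0 <= (b - a) / a by rewrite divr_ge0 ?subr_ge0// ltW.
rewrite -ln_div ?posrE// (_ : b / a = 1 + (b - a) / a); last by field; rewrite gt_eqF.
apply: le_trans (ln1D_le_powR t0 d01) _; rewrite powRM ?subr_ge0 ?invr_ge0 ?(ltW a0)//.
by rewrite -(powR_inv1 (ltW a0)) -powRrM mulN1r [X in _ * X]mulrC.
Qed.

(** Factoring out a^e leaves 1 - exp(e ln(b/a)) <= -e ln(b/a), which reduces powers to the
    logarithmic estimate. *)
Lemma powR_diff_le_powR e a b delta : e <= 0 -> 0 < a -> a <= b -> 0 < delta <= 1 ->
  a `^ e - b `^ e <= - e * delta^-1 * (a `^ (e - delta) * (b - a) `^ delta).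
Proof.
move=> e0 a0 ab d01; have b0 : 0 < b by exact: lt_le_trans ab.
have ae0 : 0 < a `^ e by exact: powR_gt0.
have bE : b `^ e = a `^ e * expR (e * (ln b - ln a)).
  rewrite -ln_div ?posrE// -ln_powR lnK ?posrE ?powR_gt0 ?divr_gt0//.
  by rewrite -powRM ?ltW ?divr_gt0// mulrCA mulfV ?mulr1// gt_eqF.
have le1 : 1 - expR (e * (ln b - ln a)) <= - e * (ln b - ln a).
  by have := expR_ge1Dx (e * (ln b - ln a)); lra.
have -> : a `^ e - b `^ e = a `^ e * (1 - expR (e * (ln b - ln a))).
  by rewrite bE; ring.
apply: (@le_trans _ _ (a `^ e * (- e * (ln b - ln a)))); first by rewrite ler_wpM2l// ltW.
rewrite (powRD (r := e) (s := - delta)) ?(gt_eqF a0) ?implybT//.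
have w : 0 <= a `^ e * - e by rewrite mulr_ge0 ?oppr_ge0// ltW.
rewrite [leLHS]mulrA; apply: le_trans (ler_wpM2l w (ln_diff_le_powR a0 ab d01)) _.
rewrite le_eqVlt; apply/orP; left; apply/eqP; ring.
Qed.

End radial_profile.

Definition signed_powR {R : realType} (p t : R) := `|t| `^ (p - 2) * t.

Section signed_power.
Context {R : realType}.
Implicit Types p t c : R.

Lemma signed_powRN p t : signed_powR p (- t) = - signed_powR p t.
Proof. by rewrite /signed_powR normrN mulrN. Qed.

Lemma signed_powRZ p c t : 0 < c -> signed_powR p (c * t) = c `^ (p - 1) * signed_powR p t.
Proof.
move=> c0; rewrite /signed_powR normrM (gtr0_norm c0) powRM ?(ltW c0)//.
rewrite (_ : p - 1 = p - 2 + 1); last by ring.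
by rewrite (powRD (r := p - 2)) ?(gt_eqF c0) ?implybT// powRr1 ?ltW//; ring.
Qed.

Lemma norm_signed_powR p t : 1 < p -> `|signed_powR p t| = `|t| `^ (p - 1).
Proof.
move=> p1; rewrite normrM ger0_norm ?powR_ge0//.
have [->|t0] := eqVneq t 0.
  by rewrite normr0 mulr0 powR0// subr_eq0 gt_eqF.
rewrite (_ : p - 1 = p - 2 + 1); last by ring.
by rewrite (powRD (r := p - 2)) ?normr_eq0 ?t0 ?implybT// powRr1.
Qed.

Lemma signed_powR_gt0 p t : 0 < t -> 0 < signed_powR p t.
Proof. by move=> t0; rewrite mulr_gt0// powR_gt0// normr_gt0 gt_eqF. Qed.

Lemma signed_powR_ge0 p t : 0 <= t -> 0 <= signed_powR p t.
Proof. by move=> t0; rewrite mulr_ge0// powR_ge0. Qed.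

End signed_power.

Section fundamental_profile.
Context {R : realType} {n : nat} (n0 : (0 < n)%N) (s p : R).
Hypotheses (s01 : 0 < s < 1) (p1 : 1 < p) (spn : s * p <= n%:R).
Local Notation L := (lebesgue_rV R n).
Local Notation V := 'rV[R]_n.
Implicit Types x y v : V.

Let u : V -> R := u0 s p.
Let e := (s * p - n%:R) / (p - 1).

Let p10 : 0 < p - 1. Proof. by rewrite subr_gt0. Qed.
Let e0 : e <= 0.
Proof. by rewrite /e ler_pdivrMr// mul0r subr_le0. Qed.
Let ep : e * (p - 1) = s * p - n%:R.
Proof. by rewrite /e mulfVK// gt_eqF. Qed.

(** One constant serves both forms of [u0]: the logarithm corresponds to e = 0 with factor 1/delta,
    and the power gives -e/delta, which is smaller than (1 - e)/delta. *)
Lemma u0_diff_le delta x y : 0 < delta <= 1 -> 0 < enorm x -> enorm x <= enorm y ->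
  0 <= u x - u y <= (1 - e) / delta * (enorm x `^ (e - delta) * enorm (x - y) `^ delta).
Proof.
move=> d01 x0 xy; have y0 : 0 < enorm y by exact: lt_le_trans xy.
have /andP[d0 d1] := d01.
have dxy : enorm y - enorm x <= enorm (x - y).
  by apply: le_trans (ler_norm _) _; rewrite enormBC ler_dist_enorm.
have dpow : (enorm y - enorm x) `^ delta <= enorm (x - y) `^ delta.
  by apply: ge0_ler_powR; rewrite ?nnegrE ?subr_ge0 ?enorm_ge0// ltW.
have V0 : 0 <= delta^-1 by rewrite invr_ge0 ltW.
rewrite /u /u0; case: eqVneq => [spE|_].
  rewrite !div1r !lnV ?posrE// opprK addrC.
  apply/andP; split; first by rewrite subr_ge0 ler_ln.
  have -> : e = 0 by rewrite /e spE subrr mul0r.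
  apply: le_trans (ln_diff_le_powR x0 xy d01) _.
  rewrite subr0 div1r sub0r; exact: (ler_wpM2l V0 (ler_wpM2l (powR_ge0 _ _) dpow)).
rewrite -/e; apply/andP; split; first by rewrite subr_ge0; exact: le0_ler_powR.
apply: le_trans (powR_diff_le_powR e0 x0 xy d01) _.
apply: ler_pM; rewrite ?mulr_ge0 ?powR_ge0 ?oppr_ge0//.
  by rewrite ler_wpM2r// lerDr.
by rewrite ler_wpM2l ?powR_ge0.
Qed.

(* Set to 0 when x or y is the origin: there the junk value of u0 would break
   the homogeneity in the logarithmic case. *)
Definition u0_kernel x y : R :=
  if (0 < enorm x) && (0 < enorm y)
  then signed_powR p (u x - u y) / enorm (x - y) `^ (n%:R + s * p) else 0.
Local Notation K := u0_kernel.

Lemma measurable_u0 : measurable_fun setT u.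
Proof.
have me := @measurable_enorm R n; rewrite /u /u0; case: (_ == _).
  apply: (measurableT_comp (@measurable_ln R)).
  under eq_fun => x do rewrite div1r -powR_inv1 ?enorm_ge0//.
  exact: measurable_funPowR.
exact: measurable_funPowR.
Qed.

Lemma measurable_u0_kernel : measurable_fun setT (fun z : V * V => K z.1 z.2).
Proof.
have m1 : measurable_fun setT (fun z : V * V => enorm z.1).
  by apply: (measurableT_comp (@measurable_enorm R n)); exact: measurable_fst.
have m2 : measurable_fun setT (fun z : V * V => enorm z.2).
  by apply: (measurableT_comp (@measurable_enorm R n)); exact: measurable_snd.
have md : measurable_fun setT (fun z : V * V => u z.1 - u z.2).
  by apply: measurable_funB; apply: (measurableT_comp measurable_u0);
    [exact: measurable_fst|exact: measurable_snd].
have mB : measurable_fun setT (fun z : V * V => enorm (z.1 - z.2)).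
  apply: (measurableT_comp (@measurable_enorm R n)).
  by apply: measurable_funBrV; [exact: measurable_fst|exact: measurable_snd].
apply: measurable_fun_ifT; last exact: measurable_cst.
  by apply: measurable_and; apply: measurable_fun_ltr => //; exact: measurable_cst.
apply: measurable_funM.
  apply: measurable_funM => //; apply: measurable_funPowR.
  by apply: (measurableT_comp (@normr_measurable R setT)).
under eq_fun => z do rewrite -powRN.
exact: measurable_funPowR.
Qed.

Lemma u0_kernelN x y : K y x = - K x y.
Proof.
rewrite /u0_kernel (andbC (0 < enorm y)) (enormBC y).
case: ((0 < enorm x) && (0 < enorm y)).
  have -> : u y - u x = - (u x - u y) by rewrite opprB.
  by rewrite signed_powRN mulNr.
by rewrite oppr0.
Qed.

Lemma u0_kernel0 y : K 0 y = 0.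
Proof. by rewrite /K enorm0 ltxx. Qed.

(** Differences of [u0] have degree e, including e = 0 for the logarithm, where a dilation adds a
    constant that cancels. The signed power has degree e(p - 1) = sp - n, and the denominator brings
    this to -2n: the exponent of [u0] is chosen for this. *)
Lemma u0_kernel_homogeneous : similarity_homogeneous (- (2 * n%:R)) K.
Proof.
split=> [a x y a0|v x y]; rewrite /K; last first.
  have -> : reflection v x - reflection v y = reflection v (x - y).
    by rewrite reflectionD -[- y]scaleN1r reflectionZ scaleN1r.
  by rewrite /u /u0 !enorm_reflection.
rewrite -scalerBr !enormZ (gtr0_norm a0) !pmulr_rgt0//.
case: ifP => [/andP[x0 y0]|_]; last by rewrite mulr0.
have aI : a `^ (- (2 * n%:R)) = a `^ (s * p - n%:R) / a `^ (n%:R + s * p).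
  by rewrite -powRB ?(gt_eqF a0) ?implybT//; congr (_ `^ _); ring.
rewrite powRM ?(ltW a0) ?enorm_ge0// aI invfM.
suff -> : signed_powR p (u (a *: x) - u (a *: y)) =
    a `^ (s * p - n%:R) * signed_powR p (u x - u y) by ring.
rewrite /u /u0 !enormZ (gtr0_norm a0); case: eqVneq => [spE|_].
  rewrite !div1r !lnV ?posrE ?mulr_gt0// !lnM ?posrE//.
  by rewrite spE subrr powRr0 mul1r; congr signed_powR; ring.
rewrite -/e !powRM ?(ltW a0) ?enorm_ge0// -mulrBr signed_powRZ ?powR_gt0//.
by rewrite -powRrM ep.
Qed.

Let absK_le delta x y : 0 < delta <= 1 -> 0 < enorm x -> enorm x <= enorm y ->
  `|signed_powR p (u x - u y)| <= ((1 - e) / delta) `^ (p - 1) *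
    (enorm x `^ (s * p - n%:R - delta * (p - 1)) * enorm (x - y) `^ (delta * (p - 1))).
Proof.
move=> d01 x0 xy; have /andP[uxy0 uxy] := u0_diff_le d01 x0 xy.
have /andP[d0 d1] := d01.
have A0 : 0 <= (1 - e) / delta.
  by rewrite mulr_ge0 ?invr_ge0 ?(ltW d0)// addr_ge0// oppr_ge0.
have B0 : 0 <= enorm x `^ (e - delta) * enorm (x - y) `^ delta by rewrite mulr_ge0 ?powR_ge0.
rewrite norm_signed_powR// ger0_norm//.
apply: (@le_trans _ _ (((1 - e) / delta * (enorm x `^ (e - delta) * enorm (x - y) `^ delta)) `^ (p - 1))).
  by apply: ge0_ler_powR; rewrite ?nnegrE ?(ltW p10)//; exact: mulr_ge0.
rewrite (powRM _ A0 B0) (powRM _ (powR_ge0 _ _) (powR_ge0 _ _)) -!powRrM.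
by rewrite (mulrBl _ e delta) ep.
Qed.

(* The bound u0_diff_le is used with delta = 1 near e1 and with a small
   delta = d2 elsewhere: the resulting powers are integrable near e1, near 0 and
   at infinity respectively. *)
Lemma u0_kernel_integrable_e1 (eta : R) : 0 < eta -> eta < s -> s * p < p - 1 + eta ->
  (\int[L]_y (`|K (e1 n) y| * enorm (e1 n - y) `^ eta)%:E < +oo)%E.
Proof.
move=> eta0 etas etap; have /andP[s0 s1] := s01.
have sps : s < s * p by rewrite ltr_pMr.
(* The bound d2 (p - 1) <= (sp - eta)/2 keeps both [a2] and [a3] positive; sp > eta because eta < s
   < sp. The minimum with 1 meets the range of [u0_diff_le]. *)
pose d2 := Num.min 1 ((s * p - eta) / (2 * (p - 1))).
have d20 : 0 < d2 by rewrite lt_min ltr01 divr_gt0 ?mulr_gt0//; lra.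
have d201 : 0 < d2 <= 1 by rewrite d20/= ge_min lexx.
have d2p : d2 * (p - 1) <= (s * p - eta) / 2.
  apply: (@le_trans _ _ ((s * p - eta) / (2 * (p - 1)) * (p - 1))).
    by rewrite ler_wpM2r ?(ltW p10)// ge_min lexx orbT.
  by rewrite invfM mulrA mulfVK// gt_eqF.
have d2p0 : 0 < d2 * (p - 1) by rewrite mulr_gt0.
pose A delta := ((1 - e) / delta) `^ (p - 1).
pose a1 := p - 1 + eta - s * p.
pose a2 := s * p - eta - d2 * (p - 1).
pose a3 := s * p - d2 * (p - 1).
have a10 : 0 < a1 by rewrite /a1; lra.
have a20 : 0 < a2 by rewrite /a2; lra.
have a30 : 0 < a3 by rewrite /a3; lra.
(* In [C1] the power of 1/2 bounds the power of |y| where |y - e1| <= 1/2, hence |y| >= 1/2. In [C3]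
   it bounds the power of |y - e1| where that distance exceeds 1/2. *)
pose C1 := A 1 * (2^-1 `^ (s * p - n%:R - 1 * (p - 1))).
pose C2 := A d2.
pose C3 := A d2 * (2^-1 `^ (- a2 - n%:R)).
have A0 d : 0 <= A d by exact: powR_ge0.
have C10 : 0 <= C1 by rewrite mulr_ge0 ?powR_ge0.
have C30 : 0 <= C3 by rewrite mulr_ge0 ?powR_ge0.
pose F1 y : R := C1 * truncated_power a1 `]0, 2^-1] (y - e1 n).
pose F2 y : R := C2 * truncated_power (- a2) `[2^-1, +oo[ (y - e1 n).
pose F3 y : R := C3 * truncated_power a3 `]0, 1] y.
have msh : measurable_fun setT (fun y : V => y - e1 n).
  by apply: measurable_funBrV; [exact: measurable_id|exact: measurable_cst].
have mF1 : measurable_fun setT F1.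
  apply: measurable_funM; first exact: measurable_cst.
  apply: (measurableT_comp (f := truncated_power a1 `]0, 2^-1])) => //.
  by apply: measurable_truncated_power; exact: measurable_itv.
have mF2 : measurable_fun setT F2.
  apply: measurable_funM; first exact: measurable_cst.
  apply: (measurableT_comp (f := truncated_power (- a2) `[2^-1, +oo[)) => //.
  by apply: measurable_truncated_power; exact: measurable_itv.
have mF3 : measurable_fun setT F3.
  apply: measurable_funM; first exact: measurable_cst.
  by apply: measurable_truncated_power; exact: measurable_itv.
have F10 y : 0 <= F1 y by rewrite mulr_ge0 ?truncated_power_ge0.
have F20 y : 0 <= F2 y by exact: (mulr_ge0 (A0 d2) (truncated_power_ge0 _ _ _)).
have F30 y : 0 <= F3 y by rewrite mulr_ge0 ?truncated_power_ge0.
have shift_fin (b : R) (I : interval R) :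
  (\int[L]_x (truncated_power b [set` I] x)%:E < +oo ->
   \int[L]_x (truncated_power b [set` I] (x - e1 n)%R)%:E < +oo)%E.
  move=> h; rewrite (ge0_integral_shift (- e1 n) (f := fun x => (truncated_power b [set` I] x)%:E)).
  - exact: h.
  - by apply/measurable_EFinP; apply: measurable_truncated_power; exact: measurable_itv.
  - by move=> x; rewrite lee_fin truncated_power_ge0.
have h2 : 0 < 2^-1 :> R by rewrite invr_gt0.
have iF1 : (\int[L]_y (F1 y)%:E < +oo)%E.
  apply: (@ge0_integralZ_fin _ _ _ L (fun y => truncated_power a1 `]0, 2^-1] (y - e1 n))).
  - apply: (measurableT_comp (f := truncated_power a1 `]0, 2^-1])) => //.
    by apply: measurable_truncated_power; exact: measurable_itv.
  - by move=> y; exact: truncated_power_ge0.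
  - exact: C10.
  - by apply: shift_fin; exact: integral_near_fin.
have iF2 : (\int[L]_y (F2 y)%:E < +oo)%E.
  apply: (@ge0_integralZ_fin _ _ _ L (fun y => truncated_power (- a2) `[2^-1, +oo[ (y - e1 n))).
  - apply: (measurableT_comp (f := truncated_power (- a2) `[2^-1, +oo[)) => //.
    by apply: measurable_truncated_power; exact: measurable_itv.
  - by move=> y; exact: truncated_power_ge0.
  - exact: A0.
  - by apply: shift_fin; exact: integral_far_fin.
have iF3 : (\int[L]_y (F3 y)%:E < +oo)%E.
  apply: (@ge0_integralZ_fin _ _ _ L (truncated_power a3 `]0, 1])).
  - by apply: measurable_truncated_power; exact: measurable_itv.
  - by move=> y; exact: truncated_power_ge0.
  - exact: C30.
  - exact: integral_near_fin.
have mK1 : measurable_fun setT (K (e1 n)).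
  exact: (measurableT_comp measurable_u0_kernel (pair1_measurable _)).
apply: (@le_integral_fin _ _ _ L _ (fun y => F1 y + (F2 y + F3 y))).
- apply: measurable_funM; first by apply: (measurableT_comp (@normr_measurable R setT)).
  apply: measurable_funPowR; apply: (measurableT_comp (@measurable_enorm R n)).
  by apply: measurable_funBrV; [exact: measurable_cst|exact: measurable_id].
- by apply: measurable_funD => //; apply: measurable_funD.
- move=> y; rewrite mulr_ge0 ?powR_ge0//=.
  rewrite /u0_kernel enorm_e1// ltr01/=.
  case: ifP => [y0|_]; last by rewrite normr0 mul0r !addr_ge0.
  set d := enorm (e1 n - y).
  have dE : enorm (y - e1 n) = d by exact: enormBC.
  have [d0|dn0] := eqVneq (e1 n - y) 0.
    move/subr0_eq: d0 => <-.
    by rewrite subrr /signed_powR mulr0 mul0r normr0 mul0r !addr_ge0.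
  have dp : 0 < d by rewrite enorm_gt0.
  have dI : 0 < d `^ (n%:R + s * p) by exact: powR_gt0.
  rewrite normrM normfV (ger0_norm (ltW dI)) -mulrA.
  have dpowE b : d `^ (b * (p - 1)) * ((d `^ (n%:R + s * p))^-1 * d `^ eta) =
      d `^ (b * (p - 1) + eta - s * p - n%:R).
    rewrite -powRN -!powRD ?(gt_eqF dp) ?implybT//.
    by congr (_ `^ _); ring.
  (* The parameter [m] stands for the smaller of the norms of e1 and y: 1 in [far], |y| in
     [near]. *)
  have key delta (m : R) :
    `|signed_powR p (u (e1 n) - u y)| <= A delta *
       (m `^ (s * p - n%:R - delta * (p - 1)) * d `^ (delta * (p - 1))) ->
    `|signed_powR p (u (e1 n) - u y)| * ((d `^ (n%:R + s * p))^-1 * d `^ eta) <=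
    A delta * (m `^ (s * p - n%:R - delta * (p - 1))) * d `^ (delta * (p - 1) + eta - s * p - n%:R).
    move=> h; rewrite -dpowE.
    have q0 : 0 <= (d `^ (n%:R + s * p))^-1 * d `^ eta by rewrite mulr_ge0 ?invr_ge0 ?powR_ge0.
    by apply: le_trans (ler_wpM2r q0 h) _; rewrite !mulrA.
  have far : 1 <= enorm y -> forall delta, 0 < delta <= 1 ->
    `|signed_powR p (u (e1 n) - u y)| * ((d `^ (n%:R + s * p))^-1 * d `^ eta) <=
    A delta * d `^ (delta * (p - 1) + eta - s * p - n%:R).
    move=> y1 delta d01; have := key delta 1; rewrite powR1 mulr1; apply.
    by have := @absK_le delta (e1 n) y d01; rewrite enorm_e1// powR1; apply.
  have near : enorm y <= 1 -> forall delta, 0 < delta <= 1 ->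
    `|signed_powR p (u (e1 n) - u y)| * ((d `^ (n%:R + s * p))^-1 * d `^ eta) <=
    A delta * (enorm y `^ (s * p - n%:R - delta * (p - 1))) * d `^ (delta * (p - 1) + eta - s * p - n%:R).
    move=> y1 delta d01; apply: key.
    have := @absK_le delta y (e1 n) d01; rewrite enorm_e1// dE => /(_ y0 y1).
    have -> : u y - u (e1 n) = - (u (e1 n) - u y) by rewrite opprB.
    by rewrite signed_powRN normrN.
  have trunc (b : R) (I : interval R) (z : V) : enorm z \in I ->
      truncated_power b [set` I] z = enorm z `^ (b - n%:R).
    by move=> zI; rewrite /truncated_power indicE (mem_set (zI : [set` I] (enorm z))) mulr1.
  have neg1 : s * p - n%:R - 1 * (p - 1) <= 0 by rewrite mul1r subr_le0 (le_trans _ (ltW p10))// subr_le0.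
  have neg2 : - a2 - n%:R <= 0 by rewrite subr_le0 (le_trans _ (ler0n R n))// oppr_le0 ltW.
  have F23 := addr_ge0 (F20 y) (F30 y).
  have [dh|dh] := leP d 2^-1.
    suff : `|signed_powR p (u (e1 n) - u y)| * ((d `^ (n%:R + s * p))^-1 * d `^ eta) <= F1 y.
      by move=> h; apply: (le_trans h); rewrite lerDl.
    rewrite /F1 trunc; last by rewrite in_itv/= dE dp.
    have E1 : 1 * (p - 1) + eta - s * p - n%:R = a1 - n%:R by rewrite /a1; ring.
    have d101 : 0 < (1 : R) <= 1 by rewrite ltr01/=.
    rewrite dE; have [y1|y1] := leP 1 (enorm y).
      apply: le_trans (far y1 1 d101) _; rewrite E1 ler_wpM2r ?powR_ge0// ler_peMr//.
      have h01 : 0 < (2^-1 : R) <= 1 by rewrite h2/=; lra.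
      by have := ger_powR h01 neg1; rewrite powRr0.
    apply: le_trans (near (ltW y1) 1 d101) _; rewrite E1 ler_wpM2r ?powR_ge0// ler_wpM2l//.
    apply: le0_ler_powR => //.
    have := ler_enormD (e1 n - y) y; rewrite subrK enorm_e1//.
    by rewrite -/d; lra.
  have [y1|y1] := leP 1 (enorm y).
    suff : `|signed_powR p (u (e1 n) - u y)| * ((d `^ (n%:R + s * p))^-1 * d `^ eta) <= F2 y.
      by move=> h; apply: (le_trans h); rewrite addrCA lerDl addr_ge0.
    rewrite /F2 trunc; last by rewrite in_itv/= dE ltW.
    apply: le_trans (far y1 d2 d201) _; rewrite dE.
    by rewrite (_ : d2 * (p - 1) + eta - s * p - n%:R = - a2 - n%:R)// /a2; ring.
  suff : `|signed_powR p (u (e1 n) - u y)| * ((d `^ (n%:R + s * p))^-1 * d `^ eta) <= F3 y.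
    by move=> h; apply: (le_trans h); rewrite addrA lerDr addr_ge0.
  rewrite /F3 trunc; last by rewrite in_itv/= y0 ltW.
  apply: le_trans (near (ltW y1) d2 d201) _.
  rewrite (_ : d2 * (p - 1) + eta - s * p - n%:R = - a2 - n%:R); last by rewrite /a2; ring.
  rewrite (_ : s * p - n%:R - d2 * (p - 1) = a3 - n%:R); last by rewrite /a3; ring.
  rewrite mulrAC ler_wpM2r ?powR_ge0// ler_wpM2l//.
  by apply: le0_ler_powR => //; exact: ltW.
- apply: ge0_integralD_fin => //; first exact: measurable_funD.
  + by move=> y; rewrite addr_ge0.
  + exact: ge0_integralD_fin.
Qed.

End fundamental_profile.

(** * Admissible functions *)

Section shifted_power_weight.
Context {R : realType} {n : nat} (n0 : (0 < n)%N) (s eta : R).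
Hypotheses (s1 : s < 1) (eta0 : 0 < eta) (etas : eta < s).
Local Notation L := (lebesgue_rV R n).
Local Notation V := 'rV[R]_n.
Implicit Types x y v : V.
Local Notation phi := (@shifted_power R n s).

Let n1 : 1 <= n%:R :> R. Proof. by rewrite ler1n. Qed.
Let eta1 : 0 < eta < 1. Proof. by rewrite eta0 (lt_trans etas). Qed.
Let sn : s - n%:R <= 0. Proof. by rewrite subr_le0 (le_trans (ltW s1)). Qed.

Let menormB : measurable_fun setT (fun x : V => enorm (x - e1 n)).
Proof.
apply: (measurableT_comp (@measurable_enorm R n)).
by apply: measurable_funBrV; [exact: measurable_id|exact: measurable_cst].
Qed.

Lemma measurable_shifted_power : measurable_fun setT phi.
Proof. exact: measurable_funPowR. Qed.

Lemma shifted_power0 : phi 0 = 1.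
Proof. by rewrite /shifted_power sub0r enormN enorm_e1// powR1. Qed.

(** The factor (n - s)/eta comes from [powR_diff_le_powR] with exponent s - n. The added 1 covers
    the pairs containing e1, where the function takes the default value 0 and the increment is |y -
    e1|^(s-n) itself. *)
Let g x : R := ((n%:R - s) / eta + 1) * enorm (x - e1 n) `^ (s - n%:R - eta).

Let C0 : 0 <= (n%:R - s) / eta.
Proof. by rewrite divr_ge0 ?(ltW eta0)// subr_ge0 (le_trans (ltW s1)). Qed.

Lemma shifted_power_holder : holder_weight eta phi g.
Proof.
move=> x y; wlog xy : x y / enorm (x - e1 n) <= enorm (y - e1 n).
  move=> h; have [|/ltW] := leP (enorm (x - e1 n)) (enorm (y - e1 n)); first exact: h.
  move=> /h H.
  have -> : g x + g y = g y + g x by exact: addrC.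
  have -> : enorm (x - y) = enorm (y - x) by exact: enormBC.
  have -> : `|phi x - phi y| = `|phi y - phi x| by exact: distrC.
  exact: H.
have g0 z : 0 <= g z by rewrite mulr_ge0 ?powR_ge0// addr_ge0.
rewrite /shifted_power; have [x0|x0] := eqVneq (x - e1 n) 0.
  have -> : x - y = - (y - e1 n) by rewrite (subr0_eq x0) opprB.
  rewrite x0 enorm0 enormN powR0 ?sub0r ?normrN; last first.
    by rewrite lt_eqF// subr_lt0 (lt_le_trans s1).
  rewrite ger0_norm ?powR_ge0//; have [->|y0] := eqVneq (y - e1 n) 0.
    rewrite enorm0 powR0; first by rewrite mulr_ge0 ?powR_ge0// addr_ge0.
    by rewrite lt_eqF// subr_lt0 (lt_le_trans s1).
  have yp : 0 < enorm (y - e1 n) by rewrite enorm_gt0.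
  apply: (@le_trans _ _ (enorm (y - e1 n) `^ eta * g y)); last first.
    by rewrite ler_wpM2l ?powR_ge0// lerDr.
  rewrite /g mulrCA -powRD ?(gt_eqF yp) ?implybT//.
  by rewrite (_ : eta + _ = s - n%:R) ?ler_peMl ?powR_ge0// ?lerDr//; ring.
have xp : 0 < enorm (x - e1 n) by rewrite enorm_gt0.
have d01 : 0 < eta <= 1 by rewrite eta0 ltW// (lt_trans etas).
rewrite ger0_norm ?subr_ge0; last exact: le0_ler_powR.
apply: le_trans (powR_diff_le_powR sn xp xy d01) _.
apply: (@le_trans _ _ (enorm (x - y) `^ eta * g x)); last first.
  by rewrite ler_wpM2l ?powR_ge0// lerDl.
have dpow : (enorm (y - e1 n) - enorm (x - e1 n)) `^ eta <= enorm (x - y) `^ eta.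
  apply: ge0_ler_powR; rewrite ?nnegrE ?subr_ge0 ?enorm_ge0// ?(ltW eta0)//.
  apply: le_trans (ler_norm _) _; apply: le_trans (ler_dist_enorm _ _) _.
  by rewrite opprB addrA subrK enormBC.
apply: (@le_trans _ _ ((n%:R - s) / eta * (enorm (x - e1 n) `^ (s - n%:R - eta) * enorm (x - y) `^ eta))).
  rewrite opprB; exact: (ler_wpM2l C0 (ler_wpM2l (powR_ge0 _ _) dpow)).
rewrite /g mulrA [leRHS]mulrC ler_wpM2r ?powR_ge0// ler_wpM2r ?powR_ge0//.
by rewrite lerDl.
Qed.

Let w x : R := enorm x `^ (eta - n%:R) * enorm (x - e1 n) `^ (s - n%:R - eta).

Let w0 x : 0 <= w x. Proof. by rewrite mulr_ge0 ?powR_ge0. Qed.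

Let mw : measurable_fun setT w.
Proof.
apply: measurable_funM; apply: measurable_funPowR => //.
exact: measurable_enorm.
Qed.

Let trunc (b : R) (I : interval R) x : enorm x \in I ->
  truncated_power b [set` I] x = enorm x `^ (b - n%:R).
Proof.
by move=> xI; rewrite /truncated_power indicE (mem_set (xI : [set` I] (enorm x))) mulr1.
Qed.

Let mtrunc (b : R) (I : interval R) :
  measurable_fun setT (truncated_power b [set` I] : V -> R).
Proof. by apply: measurable_truncated_power; exact: measurable_itv. Qed.

Let mtrunc1 (b : R) (I : interval R) :
  measurable_fun setT (fun x : V => truncated_power b [set` I] (x - e1 n)).
Proof.
apply: (measurableT_comp (mtrunc b I)).
by apply: measurable_funBrV; [exact: measurable_id|exact: measurable_cst].
Qed.

Let shift_fin (b : R) (I : interval R) :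
  (\int[L]_x (truncated_power b [set` I] x)%:E < +oo ->
   \int[L]_x (truncated_power b [set` I] (x - e1 n)%R)%:E < +oo)%E.
Proof.
move=> h; rewrite (ge0_integral_shift (- e1 n) (f := fun x => (truncated_power b [set` I] x)%:E)).
- exact: h.
- by apply/measurable_EFinP; exact: mtrunc.
- by move=> x; rewrite lee_fin truncated_power_ge0.
Qed.

Let h2 : 0 < 2^-1 :> R. Proof. by rewrite invr_gt0. Qed.

(** Measured against the critical exponent -n, [w] has excess eta > 0 at 0, s - eta > 0 at e1, and s
    - n < 0 at infinity. *)
Let w_fin : (\int[L]_x (w x)%:E < +oo)%E.
Proof.
have [i0 i1] : eta - n%:R <= 0 /\ s - n%:R - eta <= 0.
  have /andP[_ e1'] := eta1.
  by split; rewrite subr_le0 ?(le_trans sn) ?ltW// (lt_le_trans e1').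
pose A : R := 2^-1 `^ (s - n%:R - eta).
pose B : R := 2^-1 `^ (eta - n%:R).
have A0 : 0 <= A by exact: powR_ge0.
have B0 : 0 <= B by exact: powR_ge0.
have ns : 0 < n%:R - s by rewrite subr_gt0 (lt_le_trans s1).
have se : 0 < s - eta by rewrite subr_gt0.
pose G1 x : R := A * truncated_power eta `]0, 2^-1] x.
pose G2 x : R := B * truncated_power (s - eta) `]0, 2^-1] (x - e1 n).
pose G3 x : R := truncated_power (- (n%:R - s)) `[2^-1, +oo[ x.
pose G4 x : R := truncated_power (- (n%:R - s)) `[2^-1, +oo[ (x - e1 n).
have G10 x : 0 <= G1 x by exact: (mulr_ge0 A0 (truncated_power_ge0 _ _ _)).
have G20 x : 0 <= G2 x by exact: (mulr_ge0 B0 (truncated_power_ge0 _ _ _)).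
have G30 x : 0 <= G3 x by exact: truncated_power_ge0.
have G40 x : 0 <= G4 x by exact: truncated_power_ge0.
have mG1 : measurable_fun setT G1 by apply: measurable_funM; [exact: measurable_cst|exact: mtrunc].
have mG2 : measurable_fun setT G2 by apply: measurable_funM; [exact: measurable_cst|exact: mtrunc1].
have mG3 : measurable_fun setT G3 by exact: mtrunc.
have mG4 : measurable_fun setT G4 by exact: mtrunc1.
have iG1 : (\int[L]_x (G1 x)%:E < +oo)%E.
  apply: (@ge0_integralZ_fin _ _ _ L (truncated_power eta `]0, 2^-1])).
  - exact: mtrunc.
  - by move=> x; exact: truncated_power_ge0.
  - exact: A0.
  - exact: integral_near_fin.
have iG2 : (\int[L]_x (G2 x)%:E < +oo)%E.
  apply: (@ge0_integralZ_fin _ _ _ L (fun x => truncated_power (s - eta) `]0, 2^-1] (x - e1 n))).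
  - exact: mtrunc1.
  - by move=> x; exact: truncated_power_ge0.
  - exact: B0.
  - by apply: shift_fin; exact: integral_near_fin.
have iG3 : (\int[L]_x (G3 x)%:E < +oo)%E by exact: integral_far_fin.
have iG4 : (\int[L]_x (G4 x)%:E < +oo)%E by apply: shift_fin; exact: integral_far_fin.
have G120 x : 0 <= G1 x + G2 x by rewrite addr_ge0.
have G340 x : 0 <= G3 x + G4 x by rewrite addr_ge0.
apply: (@le_integral_fin _ _ _ L _ (fun x => (G1 x + G2 x) + (G3 x + G4 x))).
- exact: mw.
- by apply: measurable_funD; apply: measurable_funD.
- move=> x; rewrite w0/= /w.
  have [->|x0] := eqVneq x 0.
    rewrite enorm0 powR0 ?mul0r ?addr_ge0//.
    by have /andP[_ e1'] := eta1; rewrite lt_eqF// subr_lt0 (lt_le_trans e1').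
  have [->|xe] := eqVneq (x - e1 n) 0.
    by rewrite enorm0 powR0 ?mulr0 ?addr_ge0// lt_eqF//; move: sn eta0; lra.
  have xp : 0 < enorm x by rewrite enorm_gt0.
  have xep : 0 < enorm (x - e1 n) by rewrite enorm_gt0.
  have tri : 1 <= enorm x + enorm (x - e1 n).
    by rewrite -[leLHS](enorm_e1 R n0) -[X in enorm X <= _](subKr x) (le_trans (ler_enormD _ _))// enormN.
  have [xh|xh] := leP (enorm x) 2^-1.
    apply: (@le_trans _ _ (G1 x)); last by rewrite -addrA lerDl addr_ge0.
    rewrite /G1 trunc ?in_itv/= ?xp// mulrC ler_wpM2r ?powR_ge0//.
    by apply: le0_ler_powR => //; lra.
  have [xeh|xeh] := leP (enorm (x - e1 n)) 2^-1.
    apply: (@le_trans _ _ (G2 x)); last by rewrite addrAC lerDr addr_ge0.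
    rewrite /G2 trunc ?in_itv/= ?xep// (_ : s - eta - n%:R = s - n%:R - eta); last by ring.
    by rewrite ler_wpM2r ?powR_ge0// le0_ler_powR// ltW.
  apply: (@le_trans _ _ (G3 x + G4 x)); last by rewrite lerDr.
  rewrite /G3 /G4 !trunc ?in_itv/= ?andbT ?(ltW xh) ?(ltW xeh)//.
  have E t : 0 < t -> t `^ (- (n%:R - s) - n%:R) = t `^ (eta - n%:R) * t `^ (s - n%:R - eta).
    by move=> t0; rewrite -powRD ?(gt_eqF t0) ?implybT//; congr (_ `^ _); ring.
  (* Both exponents are nonpositive, so replacing the larger of the two distances by the smaller
     bounds [w] by a pure power centred at 0 or at e1. *)
  rewrite !E//; have [le|/ltW le] := leP (enorm x) (enorm (x - e1 n)).
    apply: ler_wpDr; first by rewrite mulr_ge0 ?powR_ge0.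
    by rewrite ler_wpM2l ?powR_ge0// le0_ler_powR.
  apply: ler_wpDl; first by rewrite mulr_ge0 ?powR_ge0.
  by rewrite ler_wpM2r ?powR_ge0// le0_ler_powR.
- apply: ge0_integralD_fin => //.
  + exact: measurable_funD.
  + exact: measurable_funD.
  + exact: ge0_integralD_fin.
  + exact: ge0_integralD_fin.
Qed.

Lemma shifted_power_weight : weight eta g.
Proof.
have Cg : 0 <= (n%:R - s) / eta + 1 by rewrite addr_ge0.
split.
- by apply: measurable_funM; [exact: measurable_cst|exact: measurable_funPowR].
- by move=> x; rewrite mulr_ge0 ?powR_ge0.
rewrite (eq_integral (fun x => (((n%:R - s) / eta + 1) * w x)%:E)); last first.
  by move=> x _; rewrite /g mulrCA.
exact: ge0_integralZ_fin.
Qed.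

Lemma shifted_power_vanishing :
  vanishing_at0 (fun x => phi x - phi 0 * tent x).
Proof.
have mpsi : measurable_fun setT (fun x : V => phi x - phi 0 * tent x).
  apply: measurable_funB; first exact: measurable_shifted_power.
  by apply: measurable_funM; [exact: measurable_cst|exact: measurable_tent].
split; first exact: mpsi.
pose A : R := 2^-1 `^ (s - n%:R - eta).
pose Cg := (n%:R - s) / eta + 1.
pose D : R := 2^-1 `^ (- eta).
(* The term 2 Cg A bounds g(x) + g(0) for |x| <= 1/2, the 1 is the Lipschitz constant of the tent,
   and D makes D |x|^eta >= 1 for |x| > 1/2. *)
pose C5 := 2 * (Cg * A) + 1 + D.
have Cg0 : 0 <= Cg by rewrite addr_ge0.
have A0 : 0 <= A by exact: powR_ge0.
have D0 : 0 <= D by exact: powR_ge0.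
have CA0 : 0 <= Cg * A by exact: mulr_ge0.
have C50 : 0 <= C5 by rewrite /C5; lra.
have T0 : 0 <= 3 `^ eta :> R by exact: powR_ge0.
have neg : s - n%:R - eta <= 0 by move: sn eta0; lra.
have /andP[_ eta1'] := eta1.
have h01 : 0 < (2^-1 : R) <= 1 by rewrite h2/=; lra.
have h21 : 2^-1 <= 1 :> R by case/andP: h01.
have A1 : 1 <= A by have := ger_powR h01 neg; rewrite powRr0.
pose G x : R := truncated_power eta `]0, 1] x.
have mG : measurable_fun setT G by exact: mtrunc.
have G0 x : 0 <= G x by exact: truncated_power_ge0.
apply: (@le_integral_fin _ _ _ L _ (fun x => C5 * G x + 3 `^ eta * w x)).
- apply: measurable_funM; first by apply: (measurableT_comp (@normr_measurable R setT)).
  by apply: measurable_funPowR; exact: measurable_enorm.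
- by apply: measurable_funD; (apply: measurable_funM; first exact: measurable_cst).
- move=> x; rewrite mulr_ge0 ?powR_ge0//=.
  have R0 : 0 <= C5 * G x + 3 `^ eta * w x by rewrite addr_ge0// mulr_ge0.
  have [x0|x0] := eqVneq x 0.
    have -> : enorm x `^ (- n%:R) = 0.
      by rewrite x0 enorm0 powR0// oppr_eq0 pnatr_eq0 -lt0n.
    rewrite mulr0; exact: R0.
  have xp : 0 < enorm x by rewrite enorm_gt0.
  have nE (b : R) : enorm x `^ b * enorm x `^ (- n%:R) = enorm x `^ (b - n%:R).
    by rewrite -powRD// (gt_eqF xp) implybT.
  rewrite shifted_power0 mul1r.
  have [xh|xh] := leP (enorm x) 2^-1.
    have tri : 1 <= enorm x + enorm (x - e1 n).
      by rewrite -[leLHS](enorm_e1 R n0) -[X in enorm X <= _](subKr x) (le_trans (ler_enormD _ _))// enormN.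
    have gx : g x <= Cg * A.
      by rewrite ler_wpM2l// le0_ler_powR//; lra.
    have g00 : g 0 <= Cg * A.
      by rewrite /g sub0r enormN enorm_e1// powR1 ler_wpM2l.
    have psiE : `|phi x - tent x| <= C5 * enorm x `^ eta.
      have -> : phi x - tent x = (phi x - phi 0) + (tent (0 : V) - tent x).
        by rewrite shifted_power0 tent0 addrA subrK.
      apply: le_trans (ler_normD _ _) _.
      have h1 := shifted_power_holder x 0; rewrite subr0 in h1.
      have h3 : `|tent (0 : V) - tent x| <= enorm x `^ eta.
        apply: le_trans (tent_lipschitz _ _) _; rewrite sub0r enormN.
        by apply: ger1_powR; [rewrite xp/=; exact: le_trans xh h21|exact: ltW].
      have h4 : enorm x `^ eta * (g x + g 0) <= enorm x `^ eta * (2 * (Cg * A)).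
        rewrite (mulr_natl (Cg * A)) mulr2n.
        exact: (ler_wpM2l (powR_ge0 _ _) (lerD gx g00)).
      have h5 : 0 <= D * enorm x `^ eta by rewrite mulr_ge0 ?powR_ge0.
      have -> : C5 * enorm x `^ eta =
          enorm x `^ eta * (2 * (Cg * A)) + (enorm x `^ eta + D * enorm x `^ eta).
        by rewrite /C5; ring.
      by apply: lerD; [exact: le_trans h1 h4|apply: ler_wpDr h5 h3].
    apply: ler_wpDr; first exact: (mulr_ge0 T0 (w0 x)).
    rewrite /G trunc; last by rewrite in_itv/= xp/=; exact: le_trans xh h21.
    rewrite -nE mulrA; apply: ler_wpM2r => //; exact: powR_ge0.
  (* For |x| > 1/2, |x - e1| <= |x| + 1 <= 3|x|; this trades |x - e1|^eta for |x|^eta and produces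
     [w]. *)
  have phiE : phi x * enorm x `^ (- n%:R) <= 3 `^ eta * w x.
    rewrite /shifted_power; have [->|xe] := eqVneq (x - e1 n) 0.
      have sn0 : s - n%:R != 0 by rewrite lt_eqF// subr_lt0 (lt_le_trans s1).
      rewrite enorm0 (powR0 sn0) mul0r; exact: (mulr_ge0 T0 (w0 x)).
    have xep : 0 < enorm (x - e1 n) by rewrite enorm_gt0.
    have le3 : enorm (x - e1 n) <= 3 * enorm x.
      apply: le_trans (ler_enormD _ _) _; rewrite enormN enorm_e1//; lra.
    have le3e : enorm (x - e1 n) `^ eta <= 3 `^ eta * enorm x `^ eta.
      rewrite -powRM ?enorm_ge0//.
      by apply: ge0_ler_powR; rewrite ?nnegrE ?enorm_ge0 ?mulr_ge0 ?(ltW eta0) ?enorm_ge0.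
    rewrite (_ : s - n%:R = (s - n%:R - eta) + eta); last by ring.
    rewrite (powRD (r := s - n%:R - eta)) ?(gt_eqF xep) ?implybT// /w -nE.
    set P := _ `^ (s - n%:R - eta); set Q := _ `^ (- n%:R).
    have PQ : 0 <= P * Q by rewrite mulr_ge0 ?powR_ge0.
    apply: (@le_trans _ _ ((P * Q) * (3 `^ eta * enorm x `^ eta))).
      by rewrite mulrAC; exact: ler_wpM2l.
    rewrite le_eqVlt; apply/orP; left; apply/eqP; ring.
  have tentE : tent x * enorm x `^ (- n%:R) <= C5 * G x.
    have [x1|x1] := leP 1 (enorm x).
      by rewrite (tent_out x1) mul0r; exact: (mulr_ge0 C50 (G0 x)).
    rewrite /G trunc; last by rewrite in_itv/= xp ltW.
    have t1 : tent x <= 1 by rewrite -(@tent0 R n) tent_le// enorm0 enorm_ge0.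
    have DE : 1 <= D * enorm x `^ eta.
      rewrite /D powRN mulrC ler_pdivlMr ?powR_gt0// mul1r.
      by apply: ge0_ler_powR; rewrite ?nnegrE ?enorm_ge0 ?(ltW eta0)// ltW.
    rewrite -nE mulrA ler_wpM2r ?powR_ge0//; apply: (le_trans t1); apply: (le_trans DE).
    by rewrite ler_wpM2r ?powR_ge0// lerDr addr_ge0// mulr_ge0.
  rewrite [leRHS]addrC; apply: le_trans (lerD phiE tentE); rewrite -mulrDl.
  apply: ler_wpM2r; first exact: powR_ge0.
  have p0 : 0 <= phi x by exact: powR_ge0.
  have t0 : 0 <= tent x by rewrite /tent le_max lexx.
  have := ler_normB (phi x) (tent x); rewrite (ger0_norm p0) (ger0_norm t0); exact.
- apply: ge0_integralD_fin.
  + by apply: measurable_funM; [exact: measurable_cst|exact: mG].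
  + by apply: measurable_funM; [exact: measurable_cst|exact: mw].
  + by move=> x; exact: mulr_ge0.
  + by move=> x; exact: mulr_ge0.
  + by apply: ge0_integralZ_fin; [exact: mG|exact: G0|exact: C50|exact: integral_near_fin].
  + by apply: ge0_integralZ_fin; [exact: mw|exact: w0|exact: T0|exact: w_fin].
Qed.

End shifted_power_weight.

(** * Test functions are Lipschitz, compactly supported and measurable *)

Section smooth_compactly_supported.
Context {R : realType} {n : nat}.
Local Notation V := 'rV[R]_n.
Implicit Types (x y : V) (phi : V -> R).

Lemma coord_le_norm x i : `|x ord0 i| <= `|x|.
Proof.
rewrite -[leRHS]/(mx_norm x) mx_normrE.
exact: (le_bigmax_cond 0 (fun ij : 'I_1 * 'I_n => `|x ij.1 ij.2|) (isT : xpredT (ord0, i))).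
Qed.

Lemma enorm_le_norm x : enorm x <= n%:R * `|x|.
Proof.
apply: le_trans (enorm_le_sum x) _.
apply: (@le_trans _ _ (\sum_(i < n) `|x|)).
  by apply: ler_sum => i _; exact: coord_le_norm.
by rewrite sumr_const card_ord -[X in X <= _]mulr_natl.
Qed.

Lemma compact_bound (A : set V) phi : compact A -> continuous phi ->
  exists2 M, 0 < M & forall x, A x -> `|phi x| <= M.
Proof.
move=> cA cphi.
have : compact (phi @` A).
  by apply: continuous_compact => //; exact: continuous_subspaceT.
move=> /compact_bounded[M [_ HM]]; exists (`|M| + 1).
  by rewrite ltr_wpDl.
move=> x Ax; apply: (HM (`|M| + 1)); last by exists x.
by rewrite (le_lt_trans (ler_norm _))// ltrDl.
Qed.

Lemma Cc_infty_support phi : Cc_infty phi ->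
  exists2 M, 0 < M & forall x, M < enorm x -> phi x = 0.
Proof.
move=> [_ /compact_bounded[M [_ HM]]].
exists (n%:R * (`|M| + 1) + 1).
  by rewrite ltr_wpDl// mulr_ge0// addr_ge0.
move=> x xM; apply/eqP/negPn/negP => px.
have := HM (`|M| + 1); rewrite (le_lt_trans (ler_norm _)) ?ltrDl// => /(_ isT x).
move=> /(_ (@subset_closure _ _ x px))/= xle.
have := le_trans (enorm_le_norm x) (ler_wpM2l (ler0n R n) xle).
by rewrite leNgt (lt_trans _ xM)// ltrDl.
Qed.

(** On the compact closure of the support continuity bounds each partial derivative; off it phi is
    locally 0, so the derivative vanishes. *)
Lemma Cc_infty_derive_bound phi : Cc_infty phi ->
  exists2 C, 0 < C & forall i x, `|'D_('e_i) phi x| <= C.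
Proof.
move=> [sphi cK]; set K := closure _ in cK.
have H i : exists M, 0 < M /\ forall x, `|'D_('e_i) phi x| <= M.
  have [/= cD _] := sphi [:: i].
  have [M M0 HM] := compact_bound cK cD; exists M; split => // x.
  have [/HM//|nKx] := pselect (K x).
  have -> : 'D_('e_i) phi x = 0; last by rewrite normr0 ltW.
  have near0 : \near x, phi x = cst 0 x.
    have : open (~` K) by apply: closed_openC; exact: closed_closure.
    rewrite openE => /(_ _ nKx); apply: filterS => y nKy /=.
    by apply/eqP/negPn/negP => py; apply: nKy; exact: subset_closure.
  by rewrite (near_eq_derive _ near0) derive_cst.
have [f Hf] := choice H.
exists (1 + \sum_(i < n) f i).
  by rewrite ltr_wpDr// sumr_ge0// => i _; rewrite ltW// (Hf i).1.
move=> i x; apply: le_trans ((Hf i).2 x) _; rewrite (bigD1 i)//=.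
by rewrite addrCA lerDl addr_ge0// sumr_ge0// => j _; rewrite ltW// (Hf j).1.
Qed.

Lemma derivable_line phi x i (t : R) : derivable phi (x + t *: 'e_i) 'e_i ->
  is_derive t 1 (fun t => phi (x + t *: 'e_i)) ('D_('e_i) phi (x + t *: 'e_i)).
Proof.
move=> dphi.
have E : (fun h : R => h^-1 *: ((fun t => phi (x + t *: 'e_i)) (h *: (1 : R) + t) - phi (x + t *: 'e_i))) =
  (fun h : R => h^-1 *: (phi (h *: 'e_i + (x + t *: 'e_i)) - phi (x + t *: 'e_i))).
  apply/funext => h; congr (_ *: (phi _ - _)).
  by rewrite [h *: 1]mulr1 scalerDl addrCA.
split.
  by rewrite /derivable E.
by rewrite /derive E.
Qed.

(** Smoothness is expressed by partial derivatives, so the path from y to x changes one coordinate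
    at a time; on each of the n segments the mean value theorem costs at most C |x - y|. *)
Lemma Cc_infty_lipschitz phi : Cc_infty phi ->
  exists2 C, 0 <= C & forall x y, `|phi x - phi y| <= C * enorm (x - y).
Proof.
move=> cphi; have [C C0 HC] := Cc_infty_derive_bound cphi.
have [sphi _] := cphi; have [/= cont der] := sphi [::].
have step x i (h : R) : `|phi (x + h *: 'e_i) - phi x| <= C * `|h|.
  pose f t := phi (x + t *: 'e_i).
  have df (t : R) : is_derive t 1 f ('D_('e_i) phi (x + t *: 'e_i)).
    by apply: derivable_line; exact: der.
  have cf : continuous f.
    move=> t; apply: differentiable_continuous; apply/derivable1_diffP.
    by case: (df t).
  have mvt a b : a <= b -> `|f b - f a| <= C * (b - a).
    move=> ab; have [c _ ->] := MVT_segment ab (fun t _ => df t) (continuous_subspaceT cf).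
    by rewrite normrM (ger0_norm (x := b - a)) ?subr_ge0// ler_wpM2r ?subr_ge0.
  have fx : phi x = f 0 by rewrite /f scale0r addr0.
  rewrite fx -/(f h); have [h0|h0] := leP 0 h.
    by have := mvt _ _ h0; rewrite subr0 (ger0_norm h0).
  by have := mvt _ _ (ltW h0); rewrite sub0r distrC (ltr0_norm h0).
exists (n%:R * C); first by rewrite mulr_ge0// ltW.
move=> x y.
pose z k : V := \row_i (if (i < k)%N then x ord0 i else y ord0 i).
have zk k : (k <= n)%N -> `|phi (z k) - phi y| <= k%:R * C * enorm (x - y).
  elim: k => [_|k IHk kn].
    rewrite (_ : z 0%N = y) ?subrr ?normr0 ?mul0r//.
    by apply/rowP => i; rewrite mxE ltn0.
  have zE : z k.+1 = z k + (x ord0 (Ordinal kn) - y ord0 (Ordinal kn)) *: 'e_(Ordinal kn).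
    apply/rowP => i; rewrite !mxE eqxx/= ltnS leq_eqVlt.
    have [/eqP ik|ik] := boolP (val i == k).
      have -> : i = Ordinal kn by exact: val_inj.
      by rewrite /= ltnn eqxx mulr1 addrC subrK.
    have -> : (i == Ordinal kn) = false by apply/negbTE.
    by rewrite mulr0 addr0.
  have -> : phi (z k.+1) - phi y = (phi (z k) - phi y) + (phi (z k.+1) - phi (z k)).
    by ring.
  apply: le_trans (ler_normD _ _) _.
  rewrite -natr1 !mulrDl mul1r lerD//; first exact: IHk (ltnW kn).
  rewrite zE; apply: le_trans (step _ _ _) _; rewrite ler_wpM2l ?(ltW C0)//.
  by have := le_coord_enorm (x - y) (Ordinal kn); rewrite !mxE.
have := zk n (leqnn n); rewrite (_ : z n = x)//.
by apply/rowP => i; rewrite mxE ltn_ord.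
Qed.

Lemma rV_rat_dense x (eps : R) : 0 < eps ->
  exists q : 'rV[rat]_n, enorm (x - map_mx ratr q) < eps.
Proof.
move=> eps0; have d0 : 0 < eps / n.+1%:R by rewrite divr_gt0.
have H i : exists q : rat, x ord0 i < ratr q < x ord0 i + eps / n.+1%:R.
  have : x ord0 i < x ord0 i + eps / n.+1%:R by rewrite ltrDl.
  by move=> /rat_in_itvoo[q]; rewrite in_itv/= => ?; exists q.
have [f Hf] := choice H.
exists (\row_i f i); apply: le_lt_trans (enorm_le_sum _) _.
apply: (@le_lt_trans _ _ (\sum_(i < n) eps / n.+1%:R)).
  apply: ler_sum => i _; rewrite !mxE; have /andP[h1 h2] := Hf i.
  by rewrite distrC gtr0_norm ?subr_gt0// lerBlDl ltW.
rewrite sumr_const card_ord -[X in X < _]mulr_natl mulrCA.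
by rewrite gtr_pMr// ltr_pdivrMr// mul1r ltr_nat.
Qed.

(* Only products of intervals are measurable by construction; a Lipschitz
   function is the infimum of the cones [phi q + C |x - q|] over rational [q]. *)
Lemma lipschitz_measurable phi (C : R) :
  (forall x y, `|phi x - phi y| <= C * enorm (x - y)) -> 0 <= C ->
  measurable_fun setT phi.
Proof.
move=> philip C0.
apply: (measurability _ (RGenInftyO.measurableE R)) => /= _ [_ [a ->] <-].
pose A (q : 'rV[rat]_n) := [set x : V | phi (map_mx ratr q) + C * enorm (x - map_mx ratr q) < a].
have -> : setT `&` phi @^-1` `]-oo, a[ =
    \bigcup_k (if unpickle k is Some q then A q else set0).
  apply/seteqP; split => [x [_ /=]|x [k _]].
    rewrite in_itv/= => xa.
    (* For q this close to x the cone at q stays below a at x, since phi(q) + C |x - q| <= phi(x) +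
       2C |x - q|. *)
    have e0 : 0 < (a - phi x) / (2 * (C + 1)).
      by rewrite divr_gt0 ?subr_gt0// mulr_gt0// ltr_wpDl.
    have [q xq] := rV_rat_dense x e0; exists (pickle q) => //; rewrite pickleK /A/=.
    have := philip (map_mx ratr q) x; rewrite enormBC => /(le_trans (ler_norm _)).
    have : (C + 1) * enorm (x - map_mx ratr q) * 2 < a - phi x.
      move: xq; rewrite ltr_pdivlMr; last by rewrite mulr_gt0// ltr_wpDl.
      by rewrite mulrCA mulrC (mulrC _ (C + 1)).
    have := enorm_ge0 (x - map_mx ratr q); nra.
  case: unpickle => // q; rewrite /A/= => xa; split => //=; rewrite in_itv/=.
  apply: le_lt_trans xa; rewrite -lerBlDl.
  exact: le_trans (ler_norm _) (philip _ _).
apply: bigcupT_measurable => k; case: unpickle => // q.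
have mf : measurable_fun setT (fun x => phi (map_mx ratr q) + C * enorm (x - map_mx ratr q)).
  apply: measurable_funD; first exact: measurable_cst.
  apply: measurable_funM; first exact: measurable_cst.
  apply: (measurableT_comp (@measurable_enorm R n)).
  by apply: measurable_funBrV; [exact: measurable_id|exact: measurable_cst].
have := measurable_fun_ltr mf (measurable_cst a).
by move=> /(_ measurableT [set true] I); rewrite setTI.
Qed.

End smooth_compactly_supported.

(** * The energy *)

Section energy_of_profile.
Context {R : realType} {n : nat} (n0 : (0 < n)%N) (s p : R).
Hypotheses (s01 : 0 < s < 1) (p1 : 1 < p) (spn : s * p <= n%:R).
Local Notation L := (lebesgue_rV R n).
Local Notation V := 'rV[R]_n.
Implicit Types (x y : V) (phi : V -> R).
Local Notation K := (@u0_kernel R n s p).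

Let set0_cube : [set 0] = cube 0 0 :> set V.
Proof.
apply/seteqP; split => [_ -> i|x hx] /=; first by rewrite mxE in_itv/= lexx.
apply/rowP => i; have := hx i; rewrite /= in_itv/= => /andP[h1 h2].
by rewrite mxE; apply/eqP; rewrite eq_le h1 h2.
Qed.

Let measurable_set0 : measurable ([set 0] : set V).
Proof. by rewrite set0_cube; exact: measurable_cube. Qed.

Lemma lebesgue_rV_set0 : L [set 0] = 0%E.
Proof.
rewrite set0_cube -[LHS]/(lebesgue_rV R n (cube 0 0)) lebesgue_rV_cube// subrr.
by rewrite expr0n (gtn_eqF n0).
Qed.

Lemma ae_neq0 : {ae (L \x L)%E, forall z, 0 < enorm z.1 /\ 0 < enorm z.2}.
Proof.
exists ([set 0] `*` setT `|` setT `*` [set 0]); split.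
- by apply: measurableU; apply: measurableX.
- apply: null_set_setU; [by apply: measurableX|by apply: measurableX| |].
  + apply: (etrans (product_measure1E L L measurable_set0 measurableT)).
    by transitivity (0 * L setT)%E; [congr (_ * _)%E; exact: lebesgue_rV_set0|exact: mul0e].
  + apply: (etrans (product_measure1E L L measurableT measurable_set0)).
    by transitivity (L setT * 0)%E; [congr (_ * _)%E; exact: lebesgue_rV_set0|exact: mule0].
move=> [x y] /= /not_andP[|] /negP; rewrite enorm_gt0 negbK => /eqP ->; by [left|right].
Qed.

Lemma measurable_energy_integrand phi : measurable_fun setT phi ->
  measurable_fun setT (fun z : V * V => energy_integrand s p (u0 s p) phi z.1 z.2).
Proof.
move=> mphi.
have md (f : V -> R) : measurable_fun setT f ->
    measurable_fun setT (fun z : V * V => f z.1 - f z.2).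
  by move=> mf; apply: measurable_funB; apply: (measurableT_comp mf);
    [exact: measurable_fst|exact: measurable_snd].
have mu0 := md _ (@measurable_u0 R n s p).
rewrite /energy_integrand; apply: measurable_funM.
  apply: measurable_funM; last exact: md.
  apply: measurable_funM => //; apply: measurable_funPowR.
  by apply: (measurableT_comp (@normr_measurable R setT)).
under eq_fun => z do rewrite -powRN.
apply: measurable_funPowR; apply: (measurableT_comp (@measurable_enorm R n)).
by apply: measurable_funBrV; [exact: measurable_fst|exact: measurable_snd].
Qed.

(** The integrand of the energy and the kernel form differ only where x or y is the origin, a null
    set of pairs; Fubini then identifies the iterated integral with the one over the product. *)
Lemma energy_kernel phi : measurable_fun setT phi ->
  (L \x L)%E.-integrable setT (fun z => (K z.1 z.2 * (phi z.1 - phi z.2))%:E) ->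
  energy_integrable s p (u0 s p) phi /\
  energy s p (u0 s p) phi =
    ((2^-1)%:E * \int[L \x L]_z (K z.1 z.2 * (phi z.1 - phi z.2))%:E)%E.
Proof.
move=> mphi iF.
pose E (z : V * V) := (energy_integrand s p (u0 s p) phi z.1 z.2)%:E.
pose F (z : V * V) := (K z.1 z.2 * (phi z.1 - phi z.2))%:E.
have mE : measurable_fun setT E.
  by apply/measurable_EFinP; exact: measurable_energy_integrand.
have mF : measurable_fun setT F by exact: (measurable_int _ iF).
have EF : ae_eq (L \x L)%E setT E F.
  apply: filterS ae_neq0 => z [z1 z2] _; congr EFin.
  by rewrite /u0_kernel z1 z2/= /energy_integrand/signed_powR mulrAC.
have iE : (L \x L)%E.-integrable setT E.
  apply/integrableP; split; first exact: mE.
  have /integrableP[_] := iF.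
  rewrite (ae_eq_integral (abse \o E) (abse \o F)); first by [].
  - exact: measurableT.
  - exact: (measurableT_comp (@abse_measurable R setT)).
  - exact: (measurableT_comp (@abse_measurable R setT)).
  - by apply: filterS EF => z /(_ I) EFz _; exact: (congr1 abse (esym EFz)).
split; first exact: iE.
rewrite /energy; congr (_ * _)%E.
transitivity (\int[L \x L]_z E z)%E; first exact: (integral12_prod_meas1 iE).
exact: (ae_eq_integral F E measurableT mE mF EF).
Qed.

Lemma energy_integrandZ phi (k : R) x y : 0 < k ->
  energy_integrand s p (fun x => k * u0 s p x) phi x y =
  k `^ (p - 1) * energy_integrand s p (u0 s p) phi x y.
Proof.
move=> k0; rewrite /energy_integrand -mulrBr.
have := signed_powRZ p (u0 s p x - u0 s p y) k0; rewrite /signed_powR => ->.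
by rewrite !mulrA.
Qed.

Lemma energyZ phi (k : R) : 0 < k -> energy_integrable s p (u0 s p) phi ->
  energy_integrable s p (fun x => k * u0 s p x) phi /\
  energy s p (fun x => k * u0 s p x) phi =
    ((k `^ (p - 1))%:E * energy s p (u0 s p) phi)%E.
Proof.
move=> k0 iE.
pose E (z : V * V) := (energy_integrand s p (u0 s p) phi z.1 z.2)%:E.
pose E' (z : V * V) := (energy_integrand s p (fun x => k * u0 s p x) phi z.1 z.2)%:E.
have EE z : E' z = ((k `^ (p - 1))%:E * E z)%E.
  by rewrite /E' energy_integrandZ// EFinM.
have iE' : (L \x L)%E.-integrable setT E'.
  rewrite (_ : E' = fun z => ((k `^ (p - 1))%:E * E z)%E); last exact/funext.
  exact: (integrableZl measurableT _ iE).
split; first exact: iE'.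
rewrite /energy muleCA; congr (_ * _)%E.
transitivity (\int[L \x L]_z E' z)%E; first exact: (integral12_prod_meas1 iE').
rewrite (eq_integral (fun z => ((k `^ (p - 1))%:E * E z)%E)); last by move=> z _; exact: EE.
rewrite (integralZl measurableT iE); congr (_ * _)%E.
by rewrite -(integral12_prod_meas1 iE).
Qed.

Lemma tent_form_ge0 x y : 0 <= K x y * (tent x - tent y).
Proof.
have H a b : enorm a <= enorm b -> 0 <= K a b * (tent a - tent b).
  move=> ab; rewrite /u0_kernel; case: ifP => [/andP[a0 b0]|_]; last by rewrite mul0r.
  have d1 : 0 < (1 : R) <= 1 by rewrite ltr01 lexx.
  have /andP[uab _] := u0_diff_le p1 spn d1 a0 ab.
  rewrite mulr_ge0 ?subr_ge0 ?tent_le// divr_ge0 ?powR_ge0//.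
  exact: signed_powR_ge0.
have [/H//|/ltW/H] := leP (enorm x) (enorm y).
by rewrite u0_kernelN -opprB mulrNN.
Qed.

Lemma tent_form_gt0 x y : 0 < enorm x -> enorm x <= 2^-1 -> 1 <= enorm y ->
  0 < K x y * (tent x - tent y).
Proof.
move=> x0 xh y1.
have xy : enorm x < enorm y by lra.
have y0 : 0 < enorm y by lra.
have d0 : 0 < enorm (x - y).
  by rewrite enorm_gt0 subr_eq0; apply/eqP => xyE; move: xy; rewrite xyE ltxx.
have u0_lt : u0 s p y < u0 s p x.
  rewrite /u0; case: eqVneq => [_|ne].
    by rewrite !div1r !lnV ?posrE// ltrN2 ltr_ln.
  have e0 : (s * p - n%:R) / (p - 1) < 0.
    by rewrite ltr_pdivrMr ?subr_gt0// mul0r subr_lt0 lt_def spn eq_sym ne.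
  rewrite -[_ / _]opprK !(powRN _ (- _)) ltf_pV2 ?posrE ?powR_gt0//.
  by apply: gt0_ltr_powR; rewrite ?oppr_gt0 ?nnegrE ?enorm_ge0.
rewrite /u0_kernel x0 y0/= (tent_out y1) subr0 mulr_gt0//.
  by rewrite divr_gt0 ?powR_gt0// signed_powR_gt0// subr_gt0.
by rewrite /tent lt_max; apply/orP; right; lra.
Qed.

Lemma tent_form_integral_gt0 (t : R) :
  (\int[L \x L]_z (K z.1 z.2 * (tent z.1 - tent z.2))%:E = t%:E)%E -> 0 < t.
Proof.
move=> tE.
pose F (z : V * V) := K z.1 z.2 * (tent z.1 - tent z.2).
have mF : measurable_fun setT (fun z => (F z)%:E).
  apply/measurable_EFinP; apply: measurable_funM; first exact: measurable_u0_kernel.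
  by apply: measurable_funB; apply: (measurableT_comp (@measurable_tent R n));
    [exact: measurable_fst|exact: measurable_snd].
have t0 : 0 <= t.
  by rewrite -lee_fin -tE; apply: integral_ge0 => z _; rewrite lee_fin tent_form_ge0.
rewrite lt_def t0 andbT; apply/eqP => t00.
have : ae_eq (L \x L)%E setT (fun z => (F z)%:E) (cst 0%E).
  apply/(ae_eq_integral_abs _ measurableT mF).
  rewrite (eq_integral (fun z : V * V => (F z)%:E)); first by rewrite tE t00.
  by move=> z _; rewrite gee0_abs// lee_fin tent_form_ge0.
(* Points of [cube a b] satisfy 0 < |x| <= 1/2 and those of [cube 1 2] satisfy |y| >= 1, so the form
   is positive on their product, which has positive measure and thus cannot lie in a null set. *)
pose b : R := (2 * n%:R)^-1; pose a := b / 2.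
have b0 : 0 < b by rewrite invr_gt0 mulr_gt0// ltr0n.
have a0 : 0 < a by rewrite divr_gt0.
have ab : a < b by rewrite /a; lra.
move=> [N [mN N0 NF]].
have sub : cube a b `*` cube 1 2 `<=` N.
  move=> [x y] [/= /(cube_enorm n0 a0)/andP[ax xb] /(cube_enorm n0 ltr01)/andP[y1 _]].
  apply: NF => /= /(_ I) [] /eqP; rewrite /F/= gt_eqF// tent_form_gt0//.
    exact: lt_le_trans ax.
  by apply: le_trans xb _; rewrite /b invfM mulrCA mulfV ?mulr1// pnatr_eq0 -lt0n.
have mC : measurable (cube a b `*` cube 1 2 : set (V * V)).
  by apply: measurableX; exact: measurable_cube.
have : ((L \x L) (cube a b `*` cube 1 2) <= (L \x L) N)%E.
  by apply: le_measure; rewrite ?inE.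
rewrite N0 leNgt => /negP; apply.
have -> : ((L \x L) (cube a b `*` cube 1 2) = (lebesgue_rV R n (cube a b)) * (lebesgue_rV R n (cube 1 2)))%E.
  exact: (product_measure1E L L (measurable_cube a b) (measurable_cube 1 2)).
rewrite !lebesgue_rV_cube ?(ltW ab)//; last by lra.
by rewrite -EFinM lte_fin mulr_gt0// exprn_gt0 ?subr_gt0//; lra.
Qed.

End energy_of_profile.

(** The energy has degree p - 1 in u, so the factor c^(-1/(p-1)) divides it by c; positivity of c
    selects the first branch of [fundamental_solution]. *)
Lemma weak_solution_energy (R : realType) (n : nat) (s p c : R) :
  1 < p -> 0 < c ->
  (forall phi : 'rV[R]_n -> R, Cc_infty phi -> energy_integrable s p (u0 s p) phi /\
    energy s p (u0 s p) phi = (c * phi 0)%:E) ->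
  @weak_solution_dirac R n s p (fundamental_solution s p c).
Proof.
move=> p1 c0 Hphi phi /Hphi[iE EE].
pose k := c `^ (- (1 / (p - 1))).
have k0 : 0 < k by exact: powR_gt0.
rewrite (_ : fundamental_solution s p c = fun x => k * u0 s p x); last first.
  by apply/funext => x; rewrite /fundamental_solution ltW.
have [iE' ->] := energyZ k0 iE; split; first exact: iE'.
rewrite EE -EFinM; congr EFin.
have p10 : p - 1 != 0 by rewrite subr_eq0 gt_eqF.
rewrite /k -powRrM mulNr div1r mulVf// powR_inv1 ?ltW// mulrA mulVf ?mul1r//.
by rewrite gt_eqF.
Qed.

(** Integrability is stated so that the integral giving [c] is a genuine one, and [c != 0] so that
    its negative power is not a default value. *)
Theorem theorem1p4 (R : realType) (n : nat) (s p : R) :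
  (0 < n)%N -> 0 < s < 1 -> 1 < p -> s * p <= n%:R ->
  exists c : R,
    [/\ @energy_integrable R n s p (u0 s p) (shifted_power s),
        c%:E = @energy R n s p (u0 s p) (shifted_power s),
        c != 0 &
        @weak_solution_dirac R n s p (fundamental_solution s p c)].
Proof.
move=> n0 s01 p1 spn; have /andP[s0 s1] := s01.
have [eta [eta0 etas etap]] : exists eta : R,
    [/\ 0 < eta, eta < s & s * p < p - 1 + eta].
  (* The constraint sp < p - 1 + eta reads eta > 1 - p(1 - s); [eta] is the midpoint between s and
     the larger of 0 and this bound. *)
  have h : 1 - p * (1 - s) < s.
    have : 0 < (p - 1) * (1 - s) by rewrite mulr_gt0 ?subr_gt0.
    by rewrite mulrBl; lra.
  pose m := Num.max 0 (1 - p * (1 - s)).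
  have ms : m < s by rewrite gt_max s0.
  have m0 : 0 <= m by rewrite le_max lexx.
  have m1 : 1 - p * (1 - s) <= m by rewrite le_max lexx orbT.
  by exists ((m + s) / 2); split; lra.
have eta01 : 0 < eta < 1 by rewrite eta0 (lt_trans etas).
have mK := @measurable_u0_kernel R n s p.
have KN := @u0_kernelN R n s p.
have Khom := @u0_kernel_homogeneous R n s p p1.
have K0 := @u0_kernel0 R n s p.
have Kint := u0_kernel_integrable_e1 n0 s01 p1 spn eta0 etas etap.
have [h wh hh] := tent_weight n0 eta01.
have itent := kernel_integrable n0 mK KN Khom K0 Kint (@measurable_tent R n) wh hh.
have [t tE] := integrable_fin_numP itent.
have t0 := tent_form_integral_gt0 n0 p1 spn tE.
pose c := t / 2.
have H (phi g : 'rV[R]_n -> R) : measurable_fun setT phi -> weight eta g -> holder_weight eta phi g ->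
    vanishing_at0 (fun x => phi x - phi 0 * tent x) ->
    energy_integrable s p (u0 s p) phi /\ energy s p (u0 s p) phi = (c * phi 0)%:E.
  move=> mphi wg hphi vphi.
  have iphi := kernel_integrable n0 mK KN Khom K0 Kint mphi wg hphi.
  have [iE ->] := energy_kernel n0 mphi iphi; split; first exact: iE.
  rewrite (kernel_form_dirac n0 eta01 mK KN Khom K0 Kint mphi wg hphi vphi) tE.
  by rewrite -!EFinM; congr EFin; rewrite /c; ring.
exists c; have [isp spE] : energy_integrable s p (u0 s p) (@shifted_power R n s) /\
    energy s p (u0 s p) (@shifted_power R n s) = (c * shifted_power s (0 : 'rV[R]_n))%:E.
  apply: (H _ _ _ (shifted_power_weight n0 s1 eta0 etas)).
  - exact: measurable_shifted_power.
  - exact: (shifted_power_holder n0 s1 eta0 etas).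
  - exact: (shifted_power_vanishing n0 s1 eta0 etas).
split; first exact: isp.
- by rewrite spE shifted_power0// mulr1.
- by rewrite gt_eqF// divr_gt0.
apply: weak_solution_energy => //; first by rewrite divr_gt0.
move=> phi cphi; have [C C0 philip] := Cc_infty_lipschitz cphi.
have [M M0 phiM] := Cc_infty_support cphi.
have mphi := lipschitz_measurable philip C0.
have [g wg hg] := lipschitz_weight n0 eta01 C0 M0 philip phiM.
apply: (H _ _ mphi wg hg).
(* The tent has Lipschitz constant 1, which adds |phi 0| to C; the radius M + 1 contains the
   supports of both phi and the tent. *)
apply: (@lipschitz_vanishing _ _ n0 _ (C + `|phi 0|) (M + 1)).
- by rewrite addr_ge0.
- by rewrite addr_gt0.
- apply: measurable_funB; first exact: mphi.
  by apply: measurable_funM; [exact: measurable_cst|exact: measurable_tent].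
- move=> x.
  have -> : phi x - phi 0 * tent x = (phi x - phi 0) + phi 0 * (tent (0 : 'rV[R]_n) - tent x).
    by rewrite tent0; ring.
  apply: le_trans (ler_normD _ _) _; rewrite mulrDl lerD//.
    by have := philip x 0; rewrite subr0.
  rewrite normrM ler_wpM2l//.
  by apply: le_trans (tent_lipschitz _ _) _; rewrite sub0r enormN.
- move=> x xM; rewrite phiM; last by rewrite (lt_trans _ xM)// ltrDl.
  by rewrite tent_out ?mulr0 ?subrr// ltW// (lt_trans _ xM)// ltrDr.
Qed.
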